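(* Let Assumption (A) below hold, and suppose in addition that $P(M_{0,i}>0)=1$ for all $i\in\mathcal D$. Then for every $i\in\mathcal D$, $$P(R>t\mid X_0=i)\sim K_i\,t^{-\alpha}L(t)\qquad (t\to\infty),$$ where $\mathbf K=(K_i)_{i\in\mathcal D}\in B_b$ is given by $\mathbf K=(I-G)^{-1}\mathbf q^{(1)}$ with $\mathbf q^{(1)}=(q^{(1)}_i)_{i\in\mathcal D}$. (Here $I-G$ is invertible on $B_b$ since the spectral radius of $G$ is less than $1$ by (A3).)
   Context: Let $\mathcal D$ be a countable set and $(X_n)_{n\in\mathbb Z}$ a stationary irreducible Markov chain on $\mathcal D$. Let $(Q_{n,i},M_{n,i})_{n\in\mathbb Z,i\in\mathcal D}$ be independent $\mathbb R^2$-valued random pairs, independent of $(X_n)$, such that for each fixed $i$ the pairs $(Q_{n,i},M_{n,i})_{n\in\mathbb Z}$ are i.i.d. Set $Q_n=Q_{n,X_n}$, $M_n=M_{n,X_n}$ (coefficients ''induced'' by $(X_n)$), and let $R=Q_0+\sum_{n\ge1}Q_{-n}\prod_{i=0}^{n-1}M_{-i}$ be the stationary solution of $R_n=Q_n+M_nR_{n-1}$. A function $L$ is slowly varying if $L(\lambda t)\sim L(t)$ for all $\lambda>0$; $f\sim g$ means $f(t)/g(t)\to1$ as $t\to\infty$. Assumption (A): there is $\alpha>0$ such that (A1) there is a slowly varying $L$ and constants $q_i^{(\eta)}\ge0$, $i\in\mathcal D$, $\eta\in\{-1,1\}$, with $P(\eta Q_{n,i}>t)/(t^{-\alpha}L(t))\to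 q_i^{(\eta)}$ uniformly in $i$; moreover $\sum_j q^{(1)}_j>0$ and $\sup_j\max\{q^{(1)}_j,q^{(-1)}_j\}<\infty$; (A2) there is $\beta>\alpha$ with $\sup_i E|M_{0,i}|^\beta<\infty$; (A3) with $m_i^{(\eta)}=E(|M_{0,i}|^\alpha\mathbf 1_{\{\eta M_{0,i}>0\}})$ and $m_i=m_i^{(1)}+m_i^{(-1)}$, $\sup_i m_i<1$; (A4) $\lim_{\varepsilon\to0+}P(M_{1,i}\le\varepsilon)=P(M_{1,i}\le0)$ uniformly in $i$. $B_b$ is the space of bounded real sequences indexed by $\mathcal D$ with the sup norm. $H(i,j)=P(X_n=j\mid X_{n+1}=i)$ is the transition matrix of the reversed chain; $G_\eta(i,j)=m_i^{(\eta)}H(i,j)$ for $\eta\in\{-1,1\}$, and $G(i,j)=m_iH(i,j)$. *)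

(* Defs.v *)
From HB Require Import structures.
From mathcomp Require Import all_boot all_order all_algebra.
From mathcomp Require Import all_classical all_reals all_analysis.
Set Implicit Arguments. Unset Strict Implicit. Unset Printing Implicit Defensive.
Import Order.TTheory GRing.Theory Num.Theory.
Import numFieldNormedType.Exports.
Local Open Scope classical_set_scope.
Local Open Scope ring_scope.

Section Defs.
Context {d : measure_display} {T : measurableType d} {R : realType}.
Variable (P : probability T R).

Definition Pr (A : set T) : R := fine (P A).

Definition cprob (A B : set T) : R := Pr (A `&` B) / Pr B.

Variable (D : countType).

Definition cyl (X : int -> T -> D) (s : seq (int * D)) : set T :=
  [set w | forall p, p \in s -> X p.1 w = p.2].

Definition markov_events_measurable (X : int -> T -> D) : Prop :=
  forall (n : int) (i : D), measurable [set w | X n w = i].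

Definition stationary_process (X : int -> T -> D) : Prop :=
  forall (n : int) (s : seq (int * D)),
    Pr (cyl X [seq (p.1 + n, p.2) | p <- s]) = Pr (cyl X s).

(* Markov property: P(X_{n+1}=j | X_n=i, X_{n-1}=s_0, ..., X_{n-k}=s_{k-1})
   = P(X_{n+1}=j | X_n=i), written without division *)
Definition past_event (X : int -> T -> D) (n : int) (i : D) (s : seq D) : set T :=
  cyl X ((n, i) :: [seq (n - (k.+1)%:Z, nth i s k) | k <- iota 0 (size s)]).

Definition markov_property (X : int -> T -> D) : Prop :=
  forall (n : int) (i j : D) (s : seq D),
    Pr ([set w | X (n + 1) w = j] `&` past_event X n i s) * Pr [set w | X n w = i]
    = Pr ([set w | X (n + 1) w = j] `&` [set w | X n w = i]) * Pr (past_event X n i s).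

Definition irreducible_process (X : int -> T -> D) : Prop :=
  forall i j : D, exists n : nat,
    0 < Pr ([set w | X 0 w = i] `&` [set w | X n%:Z w = j]).

Definition stationary_irreducible_markov_chain (X : int -> T -> D) : Prop :=
  [/\ markov_events_measurable X, stationary_process X, markov_property X
    & irreducible_process X].

Definition pair_event (Q M : int -> D -> T -> R) (k : int * D) (B1 B2 : set R)
  : set T := [set w | B1 (Q k.1 k.2 w) /\ B2 (M k.1 k.2 w)].

(* the pairs (Q_{n,i},M_{n,i}) are mutually independent and independent of
   the whole chain (X_n): product rule for every finite family of distinct
   indices, every measurable rectangles and every cylinder event of X *)
Definition pairs_independent_of_chain (X : int -> T -> D)
  (Q M : int -> D -> T -> R) : Prop :=
  forall (s : seq (int * D)) (B1 B2 : int * D -> set R) (c : seq (int * D)),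
    uniq s -> (forall k, measurable (B1 k)) -> (forall k, measurable (B2 k)) ->
    Pr (cyl X c `&` [set w | forall k, k \in s -> pair_event Q M k (B1 k) (B2 k) w])
    = Pr (cyl X c) * \prod_(k <- s) Pr (pair_event Q M k (B1 k) (B2 k)).

Definition pairs_identically_distributed (Q M : int -> D -> T -> R) : Prop :=
  forall (n : int) (i : D) (B1 B2 : set R), measurable B1 -> measurable B2 ->
    Pr (pair_event Q M (n, i) B1 B2) = Pr (pair_event Q M (0, i) B1 B2).

Definition pairs_measurable (Q M : int -> D -> T -> R) : Prop :=
  forall (n : int) (i : D), measurable_fun setT (Q n i) /\ measurable_fun setT (M n i).

Definition induced (X : int -> T -> D) (Q : int -> D -> T -> R) (n : int) (w : T) : R :=
  Q n (X n w) w.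

Definition partial_R (X : int -> T -> D) (Q M : int -> D -> T -> R) (N : nat) (w : T) : R :=
  \sum_(0 <= n < N.+1)
     induced X Q (- (n%:Z)) w * \prod_(0 <= k < n) induced X M (- (k%:Z)) w.

(* R = Q_0 + sum_{n>=1} Q_{-n} prod_{i=0}^{n-1} M_{-i}, taken as the limsup of
   the partial sums (equal to the sum wherever the series converges) *)
Definition R_sol (X : int -> T -> D) (Q M : int -> D -> T -> R) (w : T) : \bar R :=
  limn_esup (fun N => (partial_R X Q M N w)%:E).

(* H(i,j) = P(X_n = j | X_{n+1} = i) (stationarity: taken at n = 0) *)
Definition Hrev (X : int -> T -> D) (i j : D) : R :=
  cprob [set w | X 0 w = j] [set w | X 1 w = i].

Definition m_pos (M : int -> D -> T -> R) (alpha : R) (i : D) : \bar R :=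
  (\int[P]_w ((`|M 0 i w| `^ alpha) * (if 0 < M 0 i w then 1 else 0))%:E)%E.
Definition m_neg (M : int -> D -> T -> R) (alpha : R) (i : D) : \bar R :=
  (\int[P]_w ((`|M 0 i w| `^ alpha) * (if M 0 i w < 0 then 1 else 0))%:E)%E.

Definition Gmat (X : int -> T -> D) (M : int -> D -> T -> R) (alpha : R) (i j : D) : R :=
  fine (m_pos M alpha i + m_neg M alpha i)%E * Hrev X i j.

End Defs.

(* sum over a countable index set of a (absolutely summable) real family *)
Definition csum {R : realType} {D : countType} (f : D -> R) : R :=
  fine (\esum_(j in [set: D]) (Num.max (f j) 0)%:E)%E
  - fine (\esum_(j in [set: D]) (Num.max (- f j) 0)%:E)%E.

Definition slowly_varying {R : realType} (L : R -> R) : Prop :=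
  forall lam : R, 0 < lam -> L (lam * t) / L t @[t --> +oo] --> (1 : R).

Definition asymp_equiv {R : realType} (f g : R -> R) : Prop :=
  f t / g t @[t --> +oo] --> (1 : R).

(* Main.v *)
Require Import Defs.
From HB Require Import structures.
From mathcomp Require Import all_boot all_order all_algebra.
From mathcomp Require Import all_classical all_reals all_analysis.
From mathcomp Require Import measurable_realfun ring lra.
Import Order.TTheory GRing.Theory Num.Theory.
Import numFieldNormedType.Exports.
Local Open Scope classical_set_scope.
Local Open Scope ring_scope.

(** Write f_i(t) for the probability of R > t given X_0 = i, and let F be a nonincreasing function
    equivalent to t^(-alpha) L(t), namely the rescaled tail of one Q_{0,j0} with q_{j0} > 0.

    Where M is positive, R = Q_0 + M_0 R', with R' the same functional of the history seen from time
    -1. Given X_0 = i, the pair (Q_{0,i}, M_{0,i}) is independent of that history, and R' has tail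
    g_i = sum_j H(i,j) f_j ([one_step_law], [before_esum], [cP_M_history]). The event that Q and M
    R' are both large has probability o(F) ([joint_tail_small]), so up to replacing t by (1 - e) t
    or (1 + e) t, f_i(t) is P(Q_{0,i} > t) plus the mean of g_i(t / M_{0,i}) ([now_lim_le],
    [now_lim_ge]). Regular variation and the moment of order beta > alpha make the mean of F(t /
    M_{0,i}) equivalent to m_i F(t), uniformly in i ([rv_uniform], [mean_near]). If f_j ~ K_j F,
    this forces K_i = q_i + m_i sum_j H(i,j) K_j, that is, (I - G) K = q.

    That f_j / F has a limit comes from a contraction. If |f_i - K_i F| <= B F for large t,
    uniformly in i, one step improves B to c B + e for every e > 0, where c < 1 bounds all m_i
    ([within_contraction]). A finite initial B comes from a bound f_i <= C0 F, proved by induction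
    on the number of terms of the sum of absolute values ([now_abs_perpetuity_bound]). Iteration
    drives B to 0 ([now_lim_asymptotics]).

    An equivalence also needs K_i > 0. K is nonnegative as a limit of ratios of nonnegative
    quantities ([K_ge0]), and its zeros form a set closed under H; by irreducibility
    ([reversed_closed_full]) a single zero would give K = 0 at j0, against q_{j0} > 0. *)

(** * Regular variation: Potter bounds and a uniform estimate *)

Section RegularVariation.
Context {R : realType}.
Variables (F : R -> R) (al : R).
Hypothesis F_gt0 : forall t, 0 < F t.
Hypothesis F_noninc : forall s t, s <= t -> F t <= F s.
Hypothesis al_gt0 : 0 < al.
Hypothesis F_rv : forall l : R, 0 < l -> F (l * t) / F t @[t --> +oo] --> l `^ (- al).

Lemma rv_near (l e : R) : 0 < l -> 0 < e ->
  \forall t \near +oo, `|F (t / l) - l `^ al * F t| <= e * F t.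
Proof.
move=> l0 e0; have li0 : 0 < l^-1 by rewrite invr_gt0.
have /cvgrPdist_le /(_ _ e0) := F_rv _ li0.
apply: filterS => t.
have -> : l^-1 `^ (- al) = l `^ al.
  by rewrite -[l^-1]powR_inv1 ?ltW// -powRrM mulrN mulN1r opprK.
rewrite -(ler_pM2r (F_gt0 t)) -{2}(gtr0_norm (F_gt0 t)) -normrM mulrBl.
by rewrite divfK ?gt_eqF// distrC (mulrC l^-1).
Qed.

Lemma powRD_gt0 (x b c : R) : 0 < x -> x `^ (b + c) = x `^ b * x `^ c.
Proof. by move=> x0; rewrite powRD// (gt_eqF x0) implybT. Qed.

Lemma powR_ltr_exp (x b c : R) : 1 < x -> b < c -> x `^ b < x `^ c.
Proof.
move=> x1 bc; have x0 : 0 < x by rewrite (lt_trans _ x1).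
by rewrite /powR gt_eqF// ltr_expR ltr_pM2r// ln_gt0.
Qed.

(** Halving a large argument costs at most a factor 2^b, and m <= 2^n is reached by n halvings. The
    halving stops near a fixed threshold, where the boundedness of [F] takes over. *)
Lemma potter (b B : R) : al < b -> (forall t, F t <= B) ->
  exists2 C, 0 < C & \forall t \near +oo, forall m, 1 <= m ->
    F (t / m) <= C * m `^ b * F t.
Proof.
move=> alb FB.
have b0 : 0 < b by exact: lt_trans alb.
have e0 : 0 < 2 `^ b - 2 `^ al :> R by rewrite subr_gt0 powR_ltr_exp ?ltr1n.
have [t1 [_ t1P]] := @rv_near 2 _ ltac:(by []) e0.
pose t2 := Num.max t1 1.
have F2 t : t2 < t -> F (t / 2) <= 2 `^ b * F t.
  rewrite /t2 gt_max => /andP[t1t _]; have /ler_normlP[_] := t1P t t1t.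
  by rewrite lerBlDl -mulrDl subrKC.
have B0 : 0 <= B by rewrite (le_trans _ (FB 0))// ltW.
(* The first entry serves m <= 2; the second gives B <= C F(2 t2), which covers the t <= 2 t2 for
   which t / 2 leaves the range of the halving step. *)
pose C := Num.max (2 `^ b) (B / F (2 * t2)).
have C0 : 0 < C by rewrite lt_max powR_gt0.
exists C => //.
have main n : forall m t, 1 <= m <= 2 ^+ n -> t2 < t -> F (t / m) <= C * m `^ b * F t.
  elim: n => [|n IH] m t /andP[m1 mn] t2t.
  - have -> : m = 1 by apply/eqP; rewrite eq_le m1 mn.
    rewrite divr1 powR1 mulr1 ler_peMl ?ltW// lt_max.
    by have := @powR_ltr_exp 2 0 b ltac:(by rewrite ltr1n) b0; rewrite powRr0 => ->.
  - have [t0 m0 t20] : [/\ 0 < t, 0 < m & 0 < t2].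
      have t20 : 0 < t2 by rewrite lt_max ltr01 orbT.
      by split => //; [rewrite (lt_trans t20)|rewrite (lt_le_trans _ m1)].
    have mb1 : 1 <= m `^ b by rewrite -(powRr0 m) ler_powR// ltW.
    have [m2|m2] := leP m 2.
      apply: (@le_trans _ _ (F (t / 2))).
        by apply: F_noninc; rewrite ler_pM2l// lef_pV2 ?posrE.
      apply: le_trans (F2 _ t2t) _; rewrite ler_pM2r//.
      apply: (@le_trans _ _ C); first by rewrite le_max lexx.
      by rewrite ler_peMr// ltW.
    have [t2t'|t2t'] := leP t (2 * t2); last first.
      have -> : t / m = (t / 2) / (m / 2) by field; lra.
      have -> : C * m `^ b * F t = C * (m / 2) `^ b * (2 `^ b * F t).
        have <- : (m / 2) `^ b * 2 `^ b = m `^ b by rewrite -powRM ?divfK//; lra.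
        ring.
      apply: le_trans (IH _ _ _ _) _; last first.
      - by rewrite ler_wpM2l ?F2// mulr_ge0 ?powR_ge0// ltW.
      - by rewrite ltr_pdivlMr// mulrC.
      - by move: mn; rewrite exprS ler_pdivlMr// mul1r ler_pdivrMr// (mulrC 2) (ltW m2).
    apply: (le_trans (FB _)).
    apply: (@le_trans _ _ (C * F t)); last first.
      by rewrite ler_pM2r// ler_peMr// ltW.
    apply: (@le_trans _ _ (C * F (2 * t2))); last by rewrite ler_pM2l// F_noninc.
    by rewrite -ler_pdivrMr// le_max lexx orbT.
near=> t => m m1.
apply: (main (Num.truncn m).+1); last by near: t; apply: nbhs_pinfty_gt; exact: num_real.
rewrite m1/=; apply: (@le_trans _ _ (Num.truncn m).+1%:R).
  by rewrite ltW// truncnS_gt.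
by rewrite -natrX ler_nat ltnW// ltn_expl.
Unshelve. all: by end_near. Qed.

Lemma near_powRN_le (c e : R) : 0 < c -> 0 < e ->
  \forall t \near +oo, t `^ (- c) <= e.
Proof.
move=> c0 e0; near=> t.
have t0 : 0 < t by near: t; apply: nbhs_pinfty_gt; exact: num_real.
have te : e^-1 `^ c^-1 <= t by near: t; apply: nbhs_pinfty_ge; exact: num_real.
have tc : e^-1 <= t `^ c.
  have <- : (e^-1 `^ c^-1) `^ c = e^-1.
    by rewrite -powRrM mulVf ?gt_eqF// powRr1// invr_ge0 ltW.
  by rewrite ge0_ler_powR ?nnegrE ?powR_ge0// ltW.
by rewrite powRN -[e]invrK lef_pV2 ?posrE ?powR_gt0 ?invr_gt0.
Unshelve. all: by end_near. Qed.

(** The Potter bound at m = t with an exponent b' between al and b gives F(1) <= C t^b' F(t); the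
    remaining power t^(b' - b) tends to 0. *)
Lemma near_powRN_le_tail (b B e : R) : al < b -> (forall t, F t <= B) -> 0 < e ->
  \forall t \near +oo, t `^ (- b) <= e * F t.
Proof.
move=> alb FB e0; pose b' := (al + b) / 2.
have [alb' b'b] : al < b' /\ b' < b by rewrite /b'; split; lra.
have [C C0 CP] := potter _ _ alb' FB.
have F1 := F_gt0 1.
near=> t.
have t1 : 1 <= t by near: t; apply: nbhs_pinfty_ge; exact: num_real.
have t0 : 0 < t by rewrite (lt_le_trans _ t1).
have /(_ _ t1) : forall m, 1 <= m -> F (t / m) <= C * m `^ b' * F t by near: t.
rewrite divff ?gt_eqF// => FC.
have tb : t `^ (- (b - b')) <= e * (F 1 / C).
  by near: t; apply: near_powRN_le; rewrite ?subr_gt0// mulr_gt0// divr_gt0.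
have -> : t `^ (- b) = t `^ (- (b - b')) / t `^ b'.
  by rewrite -powRN -powRD_gt0//; congr (_ `^ _); ring.
rewrite ler_pdivrMr ?powR_gt0//; apply: le_trans tb _.
rewrite -mulrA ler_pM2l// ler_pdivrMr//; apply: le_trans FC _.
by rewrite le_eqVlt; apply/orP; left; apply/eqP; ring.
Unshelve. all: by end_near. Qed.

Lemma powR_absorb (a b C e : R) : a < b -> 0 < C -> 0 < e ->
  exists2 A, 1 <= A & forall m, A <= m -> C * m `^ a <= e * m `^ b.
Proof.
move=> ab C0 e0.
have [A' [A'r A'P]] := @near_powRN_le (b - a) (e / C)
  ltac:(by rewrite subr_gt0) ltac:(by rewrite divr_gt0).
exists (Num.max 1 (A' + 1)); first by rewrite le_max lexx.
move=> m; rewrite ge_max => /andP[m1 mA].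
have /= := A'P m (lt_le_trans (ltr_pwDr ltr01 (lexx _)) mA).
rewrite powRN ler_pdivlMr// => h.
have m0 : 0 < m by rewrite (lt_le_trans _ m1).
have -> : m `^ b = m `^ (b - a) * m `^ a.
  by rewrite -powRD_gt0//; congr (_ `^ _); ring.
rewrite mulrA ler_pM2r ?powR_gt0//.
by rewrite mulrC ler_pdivrMr ?powR_gt0 in h.
Qed.

Lemma potter_tail (b B e : R) : al < b -> (forall t, F t <= B) -> 0 < e ->
  exists2 A, 1 <= A & \forall t \near +oo, forall m, A <= m ->
    F (t / m) <= e * m `^ b * F t.
Proof.
move=> alb FB e0; pose b' := (al + b) / 2.
have [alb' b'b] : al < b' /\ b' < b by rewrite /b'; split; lra.
have [C C0 CP] := potter _ _ alb' FB.
have [A A1 AP] := powR_absorb _ _ _ _ b'b C0 e0.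
exists A => //; apply: filterS CP => t Ct m Am.
have m1 := le_trans A1 Am.
by apply: le_trans (Ct _ m1) _; rewrite ler_pM2r// AP.
Qed.

Lemma expr_unbounded (x y : R) : 1 < x -> exists n, y <= x ^+ n.
Proof.
move=> x1; pose h := x - 1; have h0 : 0 < h by rewrite subr_gt0.
have bern n : 1 + n%:R * h <= x ^+ n.
  elim: n => [|n IH]; first by rewrite mul0r addr0.
  have xE : x = 1 + h by rewrite /h; ring.
  rewrite exprS {1}xE mulrDl mul1r -natr1.
  have xn1 : 1 <= x ^+ n by apply: le_trans IH; rewrite lerDl mulr_ge0// ltW.
  have : h <= h * x ^+ n by rewrite ler_peMr// ltW.
  lra.
exists (Num.truncn (y / h)).+1.
apply: le_trans (bern _); have := truncnS_gt (y / h); rewrite ltr_pdivrMr//; lra.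
Qed.

Lemma geometric_grid (l r m : R) n : l <= m -> m < l * r ^+ n ->
  exists k : 'I_n, l * r ^+ k <= m <= l * r ^+ k.+1.
Proof.
move=> lm; elim: n => [|n IH] mn.
  by move: mn; rewrite expr0 mulr1 ltNge lm.
have [/IH[k kP]|h] := ltP m (l * r ^+ n).
  by exists (widen_ord (leqnSn n) k).
by exists ord_max; rewrite /= h ltW.
Qed.

(** Regular variation is applied at the finitely many points of a geometric grid and monotonicity
    interpolates between them. Below the grid both terms are at most e F(t); above it both are
    absorbed by m^b through the Potter bound. The weight is one that can be integrated against the
    law of M. *)
Lemma rv_uniform (b B e : R) : al < b -> (forall t, F t <= B) -> 0 < e ->
  \forall t \near +oo, forall m : R, 0 < m ->
    `|F (t / m) - m `^ al * F t| <= e * (1 + m `^ al + m `^ b) * F t.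
Proof.
move=> alb FB e0.
(* The al-th powers of successive grid points have ratio 1 + e, and the first point [l0] has al-th
   power e / 2. *)
pose r := (1 + e) `^ al^-1.
have ral : r `^ al = 1 + e.
  by rewrite -powRrM mulVf ?gt_eqF// powRr1// addr_ge0// ltW.
have r1 : 1 < r.
  have := @powR_ltr_exp (1 + e) 0 al^-1 ltac:(by rewrite ltrDl).
  by rewrite powRr0; apply; rewrite invr_gt0.
have r0 : 0 < r by rewrite (lt_trans _ r1).
pose e' := e / 2.
have e'0 : 0 < e' by rewrite divr_gt0.
pose l0 := e' `^ al^-1.
have l00 : 0 < l0 by rewrite powR_gt0.
have l0al : l0 `^ al = e' by rewrite -powRrM mulVf ?gt_eqF// powRr1// ltW.
have [A1 A11 A1P] := potter_tail _ _ _ alb FB e0.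
have [A2 A21 A2P] := powR_absorb _ _ _ _ alb ltr01 e0.
pose A := Num.max A1 A2.
have [n An] := expr_unbounded r ((A + 1) / l0) r1.
have grid : \forall t \near +oo, forall k : 'I_n.+1,
    `|F (t / (l0 * r ^+ k)) - (l0 * r ^+ k) `^ al * F t| <= e' * F t.
  by apply: filter_forall => k; apply: rv_near; rewrite // mulr_gt0// exprn_gt0.
near=> t => m m0.
have t0 : 0 < t by near: t; apply: nbhs_pinfty_gt; exact: num_real.
have gridt : forall k : 'I_n.+1,
    `|F (t / (l0 * r ^+ k)) - (l0 * r ^+ k) `^ al * F t| <= e' * F t by near: t.
have pot : forall m, A1 <= m -> F (t / m) <= e * m `^ b * F t by near: t.
have Ft := F_gt0 t.
have Ftm := F_gt0 (t / m).
have FM s u : 0 < s -> s <= u -> F (t / s) <= F (t / u).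
  move=> s0 su; apply: F_noninc; rewrite ler_pM2l// lef_pV2 ?posrE//.
  by rewrite (lt_le_trans s0).
have mal0 : 0 <= m `^ al by exact: powR_ge0.
have mb0 : 0 <= m `^ b by exact: powR_ge0.
have [ml|lm] := leP m l0.
  have := FM _ _ m0 ml; have := gridt ord0; rewrite /= expr0 mulr1 l0al.
  have : m `^ al <= e' by rewrite -l0al ge0_ler_powR ?nnegrE ?(ltW al_gt0)// ltW.
  rewrite -(ler_pM2r Ft) !ler_norml /e' => h1 /andP[_ h2] h3.
  have h4 : 0 <= m `^ al * F t by rewrite mulr_ge0// ltW.
  have h5 : 0 <= e * (m `^ al + m `^ b) * F t.
    by rewrite !mulr_ge0 ?addr_ge0 ?mal0 ?mb0 ?ler01 ?(ltW e0) ?(ltW Ft).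
  by apply/andP; split; lra.
have [Am|mA] := leP A m.
  have [Am1 Am2] : A1 <= m /\ A2 <= m by move: Am; rewrite ge_max => /andP[].
  have h2 : m `^ al * F t <= e * m `^ b * F t.
    by rewrite ler_pM2r// -[leLHS]mul1r A2P.
  have h4 := pot m Am1.
  have h5 : 0 <= e * (1 + m `^ al) * F t.
    by rewrite !mulr_ge0 ?addr_ge0 ?mal0 ?ler01 ?(ltW e0) ?(ltW Ft).
  have h6 : 0 <= m `^ al * F t by rewrite mulr_ge0// ltW.
  by rewrite ler_norml; apply/andP; split; lra.
have mlr : m < l0 * r ^+ n.
  apply: lt_le_trans mA _; rewrite mulrC -ler_pdivrMr//; apply: le_trans An.
  by rewrite ler_pM2r ?invr_gt0// lerDl.
have [k /andP[km mk]] := geometric_grid _ _ _ _ (ltW lm) mlr.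
have := gridt (lift ord0 k); have := gridt (widen_ord (leqnSn n) k).
rewrite lift0 /=; set u := l0 * r ^+ k; set v := l0 * r ^+ k.+1.
have u0 : 0 < u by rewrite mulr_gt0// exprn_gt0.
have vE : v = r * u by rewrite /v /u exprS; ring.
have vu : v `^ al = (1 + e) * u `^ al by rewrite vE powRM ?ltW// ral.
have := FM _ _ m0 mk; have := FM _ _ u0 km.
have um : u `^ al <= m `^ al by rewrite ge0_ler_powR ?nnegrE ?(ltW al_gt0)// ltW.
have mv : m `^ al <= v `^ al.
  by rewrite ge0_ler_powR ?nnegrE ?(ltW al_gt0)// ?(ltW m0)// vE ltW// mulr_gt0.
have um' : u `^ al * F t <= m `^ al * F t by rewrite ler_pM2r.
have mv' : m `^ al * F t <= v `^ al * F t by rewrite ler_pM2r.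
have um'' : e * (u `^ al * F t) <= e * (m `^ al * F t) by rewrite ler_pM2l.
rewrite vu in mv' *.
rewrite !ler_norml /e' => h1 h2 /andP[h3 h4] /andP[h5 h6].
have h7 : 0 <= e * m `^ b * F t by rewrite !mulr_ge0 ?mb0 ?(ltW e0) ?(ltW Ft).
have h8 : 0 < e * F t by rewrite mulr_gt0.
by apply/andP; split; lra.
Unshelve. all: by end_near. Qed.

End RegularVariation.

Set Implicit Arguments. Unset Strict Implicit. Unset Printing Implicit Defensive.

Lemma measurable_onset d d' (T : measurableType d) (U : measurableType d')
    (f : T -> U) (B : set U) :
  measurable_fun setT f -> measurable B -> measurable (f @^-1` B).
Proof. by move=> mf mB; rewrite -[X in measurable X]setTI; exact: mf. Qed.

(** * Laws restricted to an event *)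

Section RestrictedLaw.
Context d d' (T : measurableType d) (U : measurableType d') (R : realType).
Variables (mu : {finite_measure set T -> \bar R}) (A : set T) (f : T -> U).
Hypotheses (mA : measurable A) (mf : measurable_fun setT f).

(** Left unnormalised, so that conditional laws are compared without division. The measurability
    proofs are arguments so that the measure instances can attach to the term. *)
Definition restricted_law (_ : measurable A) (_ : measurable_fun setT f)
  (E : set U) : \bar R := mu (A `&` f @^-1` E).

Local Notation law := (restricted_law mA mf).

Let law0 : law set0 = 0%E.
Proof. by rewrite /restricted_law preimage_set0 setI0 measure0. Qed.

Let law_ge0 E : (0 <= law E)%E. Proof. exact: measure_ge0. Qed.

Let law_sigma_additive : semi_sigma_additive law.
Proof.
move=> F mF tF mUF; rewrite /restricted_law preimage_bigcup setI_bigcupr.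
apply: measure_semi_sigma_additive.
- by move=> n; apply: measurableI => //; exact: measurable_onset.
- apply/trivIsetP => /= i j _ _ ij; rewrite setIACA -preimage_setI.
  by move/trivIsetP : tF => /(_ _ _ _ _ ij) ->//; rewrite preimage_set0 setI0.
- rewrite -setI_bigcupr -preimage_bigcup.
  by apply: measurableI => //; exact: measurable_onset.
Qed.

HB.instance Definition _ := isMeasure.Build _ _ _ law law0 law_ge0 law_sigma_additive.

Let law_fin : fin_num_fun law.
Proof.
move=> E mE; apply: fin_num_measure.
by apply: measurableI => //; exact: measurable_onset.
Qed.

HB.instance Definition _ := Measure_isFinite.Build _ _ _ law law_fin.

End RestrictedLaw.

(** * The space of backward trajectories *)

Section PathSpace.
Context {R : realType} {D : countType}.

(** Entry n stands for the state n steps back together with the pairs of all states at that time.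
    [option D] supplies a default point even when [D] is not known to have one. *)
Definition trajectory : Type := nat -> option D * (D -> R * R).
HB.instance Definition _ := Pointed.on trajectory.

Definition cylinder (c : seq (option D)) (s : seq (nat * D)) (B1 B2 : nat * D -> set R) :
  set trajectory :=
  [set p | (forall n, (n < size c)%N -> (p n).1 = nth None c n) /\
    forall k, k \in s -> B1 k ((p k.1).2 k.2).1 /\ B2 k ((p k.1).2 k.2).2].

Definition cylinders : set (set trajectory) :=
  [set E | E = set0 \/ exists c s B1 B2, [/\ uniq s, forall k, measurable (B1 k),
    forall k, measurable (B2 k) & E = cylinder c s B1 B2]].

Definition mtrajectory : measurableType _ := g_sigma_algebraType cylinders.

(** Two initial segments of states are either incompatible, and the intersection is empty, or one
    extends the other; the longer one with both sets of constraints on the pairs then describes the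
    intersection. *)
Lemma cylinders_setI : setI_closed cylinders.
Proof.
move=> E E' [->|[c [s [B1 [B2 [us mB1 mB2 ->]]]]]]; first by left; rewrite set0I.
move=> [->|[c' [s' [B1' [B2' [us' mB1' mB2' ->]]]]]]; first by left; rewrite setI0.
wlog cc' : c c' s s' B1 B2 B1' B2' us us' mB1 mB2 mB1' mB2' / (size c <= size c')%N.
  move=> wl; have [cc'|/ltnW cc'] := leqP (size c) (size c'); first exact: wl.
  by rewrite setIC; exact: wl.
have [->|/set0P[p0 [[p0c _] [p0c' _]]]] :=
  eqVneq (cylinder c s B1 B2 `&` cylinder c' s' B1' B2') set0; first by left.
pose on_seq (s : seq (nat * D)) (B : nat * D -> set R) k := if k \in s then B k else setT.
have mon s1 B : (forall k, measurable (B k)) -> forall k, measurable (on_seq s1 B k).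
  by move=> mB k; rewrite /on_seq; case: ifP.
right; exists c', (undup (s ++ s')), (fun k => on_seq s B1 k `&` on_seq s' B1' k),
  (fun k => on_seq s B2 k `&` on_seq s' B2' k); split; first exact: undup_uniq.
- by move=> k; apply: measurableI; exact: mon.
- by move=> k; apply: measurableI; exact: mon.
apply/seteqP; split => p /=.
  move=> [[pc ps] [pc' ps']]; split => // k _; rewrite /on_seq.
  by split; split; case: ifPn => // kin; first [case: (ps _ kin)|case: (ps' _ kin)].
move=> [pc' pss]; split; split => //.
- move=> n nc; rewrite pc'; last exact: leq_trans cc'.
  by rewrite -p0c// -p0c'//; exact: leq_trans cc'.
- move=> k ks; have := pss k; rewrite mem_undup mem_cat ks /on_seq => /(_ isT).
  by rewrite ks => -[[? _] [? _]].
- move=> k ks; have := pss k; rewrite mem_undup mem_cat ks orbT /on_seq => /(_ isT).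
  by rewrite ks => -[[_ ?] [_ ?]].
Qed.

Lemma cylinder_nil : cylinder [::] [::] (fun=> setT) (fun=> setT) = setT.
Proof. by apply/seteqP; split. Qed.

Lemma measurable_cylinder c s B1 B2 : uniq s -> (forall k, measurable (B1 k)) ->
  (forall k, measurable (B2 k)) -> measurable (cylinder c s B1 B2 : set mtrajectory).
Proof.
by move=> us m1 m2; apply: sub_sigma_algebra; right; exists c, s, B1, B2.
Qed.

Lemma trajectory_measure_unique (mu1 mu2 : {finite_measure set mtrajectory -> \bar R}) :
  (forall c s B1 B2, uniq s -> (forall k, measurable (B1 k)) ->
    (forall k, measurable (B2 k)) ->
    mu1 (cylinder c s B1 B2) = mu2 (cylinder c s B1 B2)) ->
  forall E, measurable E -> mu1 E = mu2 E.
Proof.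
move=> cylE.
apply: (@measure_unique _ R mtrajectory cylinders (fun=> setT) _ _ _ _ mu1 mu2) => //.
- exact: cylinders_setI.
- move=> _; right; exists [::], [::], (fun=> setT), (fun=> setT).
  by rewrite cylinder_nil.
- by apply/seteqP; split => // p _; exists 0%N.
- move=> E [->|[c [s [B1 [B2 [us mB1 mB2 ->]]]]]]; first by rewrite !measure0.
  exact: cylE.
- by move=> _; rewrite ltey_eq fin_num_measure.
Qed.

Lemma measurable_state (n : nat) (o : option D) :
  measurable ([set p | (p n).1 = o] : set mtrajectory).
Proof.
pose F (c : seq (option D)) : set mtrajectory :=
  if (size c == n.+1) && (nth None c n == o) then
    cylinder c [::] (fun=> setT) (fun=> setT) else set0.
rewrite (_ : [set _ | _] = \bigcup_c F c).
  apply: countable_bigcupT_measurable => // c; rewrite /F; case: ifP => // _.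
  exact: measurable_cylinder.
apply/seteqP; split => p /=.
  move=> pn; exists [seq (p k).1 | k <- iota 0 n.+1] => //.
  rewrite /F ifT; last first.
    by rewrite size_map size_iota eqxx (nth_map 0%N) ?size_iota// nth_iota// add0n pn eqxx.
  split => // k; rewrite size_map size_iota => kn.
  by rewrite (nth_map 0%N) ?size_iota// nth_iota.
move=> [c _]; rewrite /F; case: ifP => // /andP[/eqP sc /eqP <-] [pc _].
by rewrite pc// sc.
Qed.

Definition Q_at (i : D) (n : nat) (p : mtrajectory) : R := ((p n).2 i).1.
Definition M_at (i : D) (n : nat) (p : mtrajectory) : R := ((p n).2 i).2.

Lemma measurable_Q_at i n : measurable_fun setT (Q_at i n).
Proof.
move=> _ B mB; rewrite setTI.
rewrite (_ : _ @^-1` B = cylinder [::] [:: (n, i)] (fun=> B) (fun=> setT)).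
  exact: measurable_cylinder.
apply/seteqP; split => p /=.
  by move=> pB; split => // k; rewrite inE => /eqP ->.
by move=> [_ /(_ (n, i))]; rewrite mem_head => /(_ isT)[].
Qed.

Lemma measurable_M_at i n : measurable_fun setT (M_at i n).
Proof.
move=> _ B mB; rewrite setTI.
rewrite (_ : _ @^-1` B = cylinder [::] [:: (n, i)] (fun=> setT) (fun=> B)).
  exact: measurable_cylinder.
apply/seteqP; split => p /=.
  by move=> pB; split => // k; rewrite inE => /eqP ->.
by move=> [_ /(_ (n, i))]; rewrite mem_head => /(_ isT)[].
Qed.

Definition along (f : D -> nat -> mtrajectory -> R) (n : nat) (p : mtrajectory) : R :=
  if (p n).1 is Some i then f i n p else 0.

Lemma measurable_along f n : (forall i, measurable_fun setT (f i n)) ->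
  measurable_fun setT (along f n).
Proof.
move=> mf _ B mB; rewrite setTI.
pose g (o : option D) : mtrajectory -> R := if o is Some i then f i n else cst 0.
rewrite (_ : _ @^-1` B = \bigcup_o ([set p | (p n).1 = o] `&` g o @^-1` B)).
  apply: countable_bigcupT_measurable => // o.
  apply: measurableI; first exact: measurable_state.
  by case: o => [i|]; apply: measurable_onset => //; exact: mf.
apply/seteqP; split => p /=; rewrite /along.
  by move=> pB; exists (p n).1 => //; split => //=; move: pB; case: (p n).1.
by case=> o _ [] /= ->; case: o.
Qed.

(** Horner form of the sum of N terms started at age k. It is used with [id] for R and with
    [Num.norm] for the dominating sum of absolute values. *)
Fixpoint perpetuity (f : R -> R) (N k : nat) (p : mtrajectory) : R :=
  if N is N'.+1 then
    along (fun i n p => f (Q_at i n p)) k p +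
    along (fun i n p => f (M_at i n p)) k p * perpetuity f N' k.+1 p
  else 0.

Lemma measurable_perpetuity f N k : measurable_fun setT f ->
  measurable_fun setT (perpetuity f N k).
Proof.
move=> mf; elim: N k => [|N IH] k /=; first exact: measurable_cst.
apply: measurable_funD.
  by apply: measurable_along => i; apply: measurableT_comp => //; exact: measurable_Q_at.
apply: measurable_funM; last exact: IH.
by apply: measurable_along => i; apply: measurableT_comp => //; exact: measurable_M_at.
Qed.

Definition perpetuity_lim (p : mtrajectory) : \bar R :=
  limn_esup (fun N => (perpetuity id N.+1 0 p)%:E).

Lemma measurable_perpetuity_lim : measurable_fun setT perpetuity_lim.
Proof.
apply: measurable_fun_limn_esup => N; apply/measurable_EFinP.
exact: measurable_perpetuity.
Qed.

End PathSpace.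

(** * The process as a random trajectory *)

Section History.
Context d (T : measurableType d) (R : realType) (P : probability T R) (D : countType).
Variables (X : int -> T -> D) (Q M : int -> D -> T -> R).
Hypothesis mX : markov_events_measurable X.
Hypothesis mQM : pairs_measurable Q M.

Definition history (k : int) (w : T) : @mtrajectory R D :=
  fun n => (Some (X (k - n%:Z) w), fun i => (Q (k - n%:Z) i w, M (k - n%:Z) i w)).

Lemma measurable_pair_event k B1 B2 : measurable B1 -> measurable B2 ->
  measurable (pair_event Q M k B1 B2).
Proof.
move=> mB1 mB2; have [mQ mM] := mQM k.1 k.2.
by apply: measurableI; exact: measurable_onset.
Qed.

Lemma measurable_all_in (I : choiceType) (s : seq I) (F : I -> set T) :
  (forall i, measurable (F i)) -> measurable [set w | forall i, i \in s -> F i w].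
Proof.
move=> mF.
rewrite (_ : (fun w => forall i, i \in s -> F i w) = \bigcap_(i in [set` s]) F i).
  by apply: fin_bigcap_measurable => //; exact: finite_seq.
by apply/seteqP; split=> w h i; exact: h.
Qed.

Lemma measurable_cyl c : measurable (cyl X c).
Proof. by apply: measurable_all_in => -[n i]; exact: mX. Qed.

Definition shift_index (k : int) (x : nat * D) : int * D := (k - x.1%:Z, x.2).

Lemma shift_index_inj k : injective (shift_index k).
Proof.
by move=> [n i] [n' i'] [/eqP]; rewrite (can_eq (addKr k)) eqr_opp => /eqP[<-] <-.
Qed.

Definition states_event (k : int) (c : seq D) : set T :=
  cyl X [seq shift_index k x | x <- zip (iota 0 (size c)) c].

Definition pairs_event (k : int) (s : seq (nat * D)) (B1 B2 : nat * D -> set R) : set T :=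
  [set w | forall x, x \in s -> pair_event Q M (shift_index k x) (B1 x) (B2 x) w].

Lemma history_cylinder k (c : seq D) s B1 B2 :
  history k @^-1` cylinder (map Some c) s B1 B2 =
  states_event k c `&` pairs_event k s B1 B2.
Proof.
apply/seteqP; split => w [/= wc ws]; split => //.
  move=> p /mapP[[n i] /(nthP (0%N, i))[m]].
  rewrite size_zip size_iota minnn => mc; rewrite nth_zip ?size_iota//.
  rewrite nth_iota// => -[<- ni] -> /=.
  have := wc m; rewrite size_map => /(_ mc).
  by rewrite (nth_map i)// add0n ni => -[].
move=> n; rewrite size_map => nc.
have [i0 _] : exists i0 : D, True by exists (X 0 w).
rewrite (nth_map i0)//; congr Some; apply: (wc (k - n%:Z, _)).
apply/mapP; exists (n, nth i0 c n) => //.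
apply/(nthP (0%N, i0)); exists n; first by rewrite size_zip size_iota minnn.
by rewrite nth_zip ?size_iota// nth_iota.
Qed.

Lemma history_cylinder_None k c s B1 B2 : None \in c ->
  history k @^-1` cylinder c s B1 B2 = set0.
Proof.
move=> /(nthP None)[n nc cn]; apply/seteqP; split => // w [/= /(_ _ nc)].
by rewrite cn.
Qed.

Lemma states_or_None (c : seq (option D)) : None \in c \/ exists c', c = map Some c'.
Proof.
elim: c => [|[i|] c [IH|[c' ->]]]; first by right; exists [::].
- by left; rewrite inE.
- by right; exists (i :: c').
- by left; rewrite mem_head.
- by left; rewrite mem_head.
Qed.

Lemma measurable_history k : measurable_fun setT (history k).
Proof.
apply: measurability => // _ [_ [->|[c [s [B1 [B2 [us mB1 mB2 ->]]]]]] <-].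
  by rewrite preimage_set0 setI0.
rewrite setTI; have [cN|[c' ->]] := states_or_None c.
  by rewrite history_cylinder_None.
rewrite history_cylinder; apply: measurableI; first exact: measurable_cyl.
by apply: measurable_all_in => x; exact: measurable_pair_event.
Qed.

End History.

(** * Markov property and independence seen on histories *)

Section ConditionalLaws.
Context d (T : measurableType d) (R : realType) (P : probability T R) (D : countType).
Variables (X : int -> T -> D) (Q M : int -> D -> T -> R).
Hypothesis chain : stationary_irreducible_markov_chain P X.
Hypothesis mQM : pairs_measurable Q M.
Hypothesis indep : pairs_independent_of_chain P X Q M.
Hypothesis ident : pairs_identically_distributed P Q M.

Let mX : markov_events_measurable X. Proof. by case: chain. Qed.

Lemma PrE (A : set T) : measurable A -> P A = (Pr P A)%:E.
Proof. by move=> mA; rewrite /Pr fineK// fin_num_measure. Qed.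

Lemma Pr_ge0 (A : set T) : 0 <= Pr P A.
Proof. exact: fine_ge0. Qed.

Lemma Pr_set0 : Pr P set0 = 0.
Proof. by rewrite /Pr measure0. Qed.

Lemma Pr_setT : Pr P setT = 1.
Proof. by rewrite /Pr probability_setT. Qed.

Lemma le_Pr (A B : set T) : measurable A -> measurable B -> A `<=` B -> Pr P A <= Pr P B.
Proof.
by move=> mA mB AB; rewrite fine_le ?fin_num_measure// le_measure ?inE.
Qed.

Lemma Pr_state_gt0 i : 0 < Pr P [set w | X 0 w = i].
Proof.
have [_ _ _ irr] := chain; have [n ijP] := irr i i.
by apply: lt_le_trans ijP _; apply: le_Pr => //; exact: measurableI.
Qed.

(** Cylinders form a generating class stable under intersection, so an identity of laws of histories
    reduces to finite products. *)
Lemma history_law_unique (c : R) (A1 A2 : set T) (k1 k2 : int) :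
  0 <= c -> measurable A1 -> measurable A2 ->
  (forall cc s B1 B2, uniq s -> (forall k, measurable (B1 k)) ->
    (forall k, measurable (B2 k)) ->
    Pr P (A1 `&` (states_event X k1 cc `&` pairs_event Q M k1 s B1 B2)) =
    c * Pr P (A2 `&` (states_event X k2 cc `&` pairs_event Q M k2 s B1 B2))) ->
  forall E, measurable E -> Pr P (A1 `&` history X Q M k1 @^-1` E) =
    c * Pr P (A2 `&` history X Q M k2 @^-1` E).
Proof.
move=> c0 mA1 mA2 cylE E mE.
have mh k := measurable_history mX mQM k.
pose mu1 := restricted_law P mA1 (mh k1).
pose mu2 := mscale (NngNum c0) (restricted_law P mA2 (mh k2)).
have mpre k A (F : set mtrajectory) : measurable A -> measurable F ->
    measurable (A `&` history X Q M k @^-1` F).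
  by move=> mA mF; apply: measurableI => //; exact: measurable_onset.
suff : mu1 E = mu2 E.
  rewrite /mu1 /mu2 /mscale/= /restricted_law !PrE//; [|exact: mpre..].
  by rewrite -EFinM => -[].
apply: trajectory_measure_unique => // cc s B1 B2 us mB1 mB2.
rewrite /mu1 /mu2 /= /mscale /= /restricted_law.
have [ccN|[{}cc ->]] := states_or_None cc.
  by rewrite !history_cylinder_None// !setI0 !measure0 mule0.
rewrite !PrE; [|by apply: mpre => //; exact: measurable_cylinder..].
by rewrite -EFinM !history_cylinder cylE.
Qed.

Lemma pairs_event_indep k c s B1 B2 : uniq s ->
  (forall x, measurable (B1 x)) -> (forall x, measurable (B2 x)) ->
  Pr P (cyl X c `&` pairs_event Q M k s B1 B2) =
  Pr P (cyl X c) * \prod_(x <- s) Pr P (pair_event Q M (0, x.2) (B1 x) (B2 x)).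
Proof.
(* [back] inverts [shift_index k], turning absolute times into ages; on the image of [shift_index k]
   the difference is already nonnegative. *)
move=> us mB1 mB2; pose back (z : int * D) : nat * D := (`|k - z.1|%N, z.2).
have shiftK x : back (shift_index k x) = x.
  by case: x => n i; rewrite /back /shift_index/= opprB addrC subrK.
have := @indep (map (shift_index k) s) (B1 \o back) (B2 \o back) c.
rewrite map_inj_uniq; last exact: shift_index_inj.
move=> /(_ us (fun _ => mB1 _) (fun _ => mB2 _)).
rewrite big_map (_ : [set w | forall z, z \in _ -> _] = pairs_event Q M k s B1 B2).
  move=> ->; congr (_ * _); apply: eq_bigr => x _ /=.
  by rewrite shiftK; exact: ident.
apply/seteqP; split => w h.
  by move=> x xs; have := h (shift_index k x); rewrite /= shiftK map_f// => /(_ isT).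
by move=> _ /mapP[x xs ->] /=; rewrite shiftK; exact: h.
Qed.

Lemma states_event_cons k j c : states_event X k (j :: c) = past_event X k j c.
Proof.
rewrite /states_event /past_event/= /shift_index/= subr0; congr (cyl X (_ :: _)).
apply: (@eq_from_nth _ (k, j)); first by rewrite !size_map size_zip !size_iota minnn.
move=> n; rewrite size_map size_zip size_iota minnn => nc.
rewrite (nth_map (0%N, j)) ?size_zip ?size_iota ?minnn// nth_zip ?size_iota//=.
by rewrite (nth_map 0%N) ?size_iota// !nth_iota// add1n add0n.
Qed.

Lemma cyl_cons n i c : cyl X ((n, i) :: c) = [set w | X n w = i] `&` cyl X c.
Proof.
apply/seteqP; split => w.
  move=> h; split; first exact: (h (n, i) (mem_head _ _)).
  by move=> p pc; apply: h; rewrite inE pc orbT.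
by move=> [h1 h2] p; rewrite inE => /predU1P[->//|]; exact: h2.
Qed.

Lemma cyl_nil : cyl X [::] = setT.
Proof. by apply/seteqP; split. Qed.

Lemma Pr_past_shift j c :
  Pr P (past_event X (-1) j c) = Pr P (past_event X 0 j c).
Proof.
have [_ stat _ _] := chain.
rewrite /past_event -[RHS](stat (-1)) /= add0r -map_comp; congr (Pr P (cyl X (_ :: _))).
by apply: eq_map => n /=; rewrite sub0r addrC.
Qed.

(** Given X_{-1} = j the present state is independent of the past, and by stationarity that past has
    the law of the one seen from time 0 given X_0 = j. *)
Lemma states_event_markov i j c :
  Pr P ([set w | X 0 w = i] `&` ([set w | X (-1) w = j] `&` states_event X (-1) c)) *
    Pr P [set w | X 0 w = j] =
  Pr P ([set w | X 0 w = i] `&` [set w | X (-1) w = j]) *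
    Pr P ([set w | X 0 w = j] `&` states_event X 0 c).
Proof.
have [_ stat mark _] := chain.
have Xj : Pr P [set w | X (-1) w = j] = Pr P [set w | X 0 w = j].
  by have := Pr_past_shift j [::]; rewrite /past_event /= !cyl_cons cyl_nil !setIT.
(* A nonempty segment must start with j, since otherwise both sides vanish; it is then exactly a
   past event of the Markov property. *)
case: c => [|j' c].
  by rewrite /states_event/= cyl_nil !setIT.
have [->|jj'] := eqVneq j' j; last first.
  have dis k : [set w | X k w = j] `&` states_event X k (j' :: c) = set0.
    apply/seteqP; split => // w; rewrite states_event_cons /past_event cyl_cons.
    by move=> [/= -> [/= /eqP]]; rewrite eq_sym (negbTE jj').
  by rewrite !dis setI0 Pr_set0 mulr0 mul0r.
have same k : [set w | X k w = j] `&` states_event X k (j :: c) = past_event X k j c.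
  rewrite states_event_cons /past_event cyl_cons setIA setIid//.
by rewrite !same -Pr_past_shift -Xj; have := mark (-1) j i c; rewrite addNr.
Qed.

(** Given X_0 = i and X_{-1} = j, the current pair is independent of the earlier history, which is a
    copy of the history at time 0 given X_0 = j. On cylinders this combines the product rule for the
    pairs with [states_event_markov]. *)
Lemma one_step_law i j B1 B2 E : measurable B1 -> measurable B2 -> measurable E ->
  Pr P ([set w | X 0 w = i] `&` [set w | X (-1) w = j] `&`
        pair_event Q M (0, i) B1 B2 `&` history X Q M (-1) @^-1` E) =
  Pr P (pair_event Q M (0, i) B1 B2) *
    Pr P ([set w | X 0 w = i] `&` [set w | X (-1) w = j]) / Pr P [set w | X 0 w = j] *
  Pr P ([set w | X 0 w = j] `&` history X Q M 0 @^-1` E).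
Proof.
move=> mB1 mB2; apply: history_law_unique => //.
- by rewrite !mulr_ge0 ?invr_ge0 ?Pr_ge0.
- by apply: measurableI; [exact: measurableI|exact: measurable_pair_event].
move=> cc s C1 C2 us mC1 mC2.
(* Ages counted from time -1 grow by one when counted from time 0; age 0 is taken by the current
   pair. *)
pose up (B : set R) (C : nat * D -> set R) (x : nat * D) :=
  if x.1 is n.+1 then C (n, x.2) else B.
have mup B C : measurable B -> (forall x, measurable (C x)) ->
  forall x, measurable (up B C x) by move=> mB mC [[|n] l]; rewrite /up/=.
pose s' := (0%N, i) :: [seq (x.1.+1, x.2) | x <- s].
have us' : uniq s'.
  rewrite /= map_inj_uniq ?us ?andbT; last by move=> [? ?] [? ?] [-> ->].
  by apply/negP => /mapP[].
set lst := (0, i) :: (-1, j) :: [seq shift_index (-1) x | x <- zip (iota 0 (size cc)) cc].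
rewrite [in LHS](_ : _ `&` _ = cyl X lst `&` pairs_event Q M 0 s' (up B1 C1) (up B2 C2)).
  rewrite pairs_event_indep//; [|exact: mup..].
  rewrite setIA /states_event -cyl_cons pairs_event_indep//.
  rewrite big_cons big_map /= /up/=; set pi := \prod_(x <- s) _.
  rewrite (_ : \prod_(x <- s) _ = pi); last by apply: eq_bigr => -[].
  have := states_event_markov i j cc; rewrite /states_event -!cyl_cons -/lst => h.
  have p0 := Pr_state_gt0 j.
  apply: (@mulIf _ (Pr P [set w | X 0 w = j])); first by rewrite gt_eqF.
  rewrite mulrAC h; field; by rewrite gt_eqF.
rewrite /lst !cyl_cons -/(states_event X (-1) cc).
rewrite setIACA -(setIA [set w | X 0 w = i]); congr (_ `&` _).
apply/seteqP; split => w.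
  move=> [h1 h2] x; rewrite inE => /predU1P[->|/mapP[[n l] xs ->]].
    by rewrite /shift_index/= subr0.
  have := h2 _ xs; rewrite /shift_index/= /up/= sub0r.
  by rewrite (_ : -1 - n%:Z = - n.+1%:Z)// -addn1 PoszD opprD addrC.
move=> h; split.
  by have := h (0%N, i) (mem_head _ _); rewrite /shift_index/= subr0.
move=> [n l] xs.
have xs' : (n.+1, l) \in [seq (x.1.+1, x.2) | x <- s] by apply/mapP; exists (n, l).
have := h (n.+1, l); rewrite inE xs' orbT => /(_ isT).
rewrite /shift_index/= /up/= sub0r.
by rewrite (_ : -1 - n%:Z = - n.+1%:Z)// -addn1 PoszD opprD addrC.
Qed.

End ConditionalLaws.

(** * Sums over a countable set *)

Section CountableSums.
Context {R : realType} {D : countType}.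
Local Open Scope ereal_scope.

Lemma esum_pickle (f : D -> \bar R) : (forall j, 0 <= f j) ->
  \esum_(j in [set: D]) f j = \sum_(n <oo) oapp f 0 (pickle_inv n).
Proof.
move=> f0; rewrite nneseries_esumT; last by move=> n; case: pickle_inv.
transitivity (\esum_(n in [set pickle j | j in [set: D]]) oapp f 0 (pickle_inv n)).
  rewrite esum_image; last by move=> j j' _ _ /(pcan_inj pickleK).
  by apply: eq_esum => j _; rewrite pickleK_inv.
rewrite esum_mkcond; apply: eq_esum => n _; case: ifPn => // /negP nD.
case nj: (pickle_inv n) => [j|//]; exfalso; apply: nD; apply/mem_set; exists j => //.
by have := @pickle_invK D n; rewrite /ocancel nj.
Qed.

Lemma esumZl (c : R) (f : D -> \bar R) : (0 <= c)%R -> (forall j, 0 <= f j) ->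
  \esum_(j in [set: D]) (c%:E * f j) = c%:E * \esum_(j in [set: D]) f j.
Proof.
move=> c0 f0; rewrite !esum_pickle//; last by move=> j; rewrite mule_ge0.
rewrite -nneseriesZl//; last by move=> n _; case: pickle_inv.
by apply: eq_eseriesr => n _; case: pickle_inv => //=; rewrite mule0.
Qed.

End CountableSums.

(** * Decomposition over the preceding state *)

Section OneStep.
Context d (T : measurableType d) (R : realType) (P : probability T R) (D : countType).
Variables (X : int -> T -> D) (Q M : int -> D -> T -> R).
Hypothesis chain : stationary_irreducible_markov_chain P X.
Hypothesis mQM : pairs_measurable Q M.
Hypothesis indep : pairs_independent_of_chain P X Q M.
Hypothesis ident : pairs_identically_distributed P Q M.

Let mX : markov_events_measurable X. Proof. by case: chain. Qed.

Definition cP (i : D) (E : set T) : R := cprob P E [set w | X 0 w = i].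

Lemma Pr_total (S : set T) : measurable S ->
  (Pr P S)%:E = \esum_(j in [set: D]) (Pr P (S `&` [set w | X (-1) w = j]))%:E.
Proof.
move=> mS; rewrite esum_pickle; last by move=> j; rewrite lee_fin Pr_ge0.
pose F n := if pickle_inv n is Some j then S `&` [set w | X (-1) w = j] else set0.
have mF n : measurable (F n).
  by rewrite /F; case: pickle_inv => // j; apply: measurableI => //; exact: mX.
have -> : S = \bigcup_n F n.
  apply/seteqP; split => w.
    by move=> Sw; exists (pickle (X (-1) w)) => //; rewrite /F pickleK_inv.
  by move=> [n _]; rewrite /F; case: pickle_inv => // j [].
rewrite -PrE; last exact: bigcupT_measurable.
rewrite measure_semi_bigcup//; last exact: bigcupT_measurable.
  apply: eq_eseriesr => n _; transitivity (Pr P (F n))%:E; first exact: PrE.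
  rewrite {1}/F.
  case nj: pickle_inv => [j|] /=; last by rewrite Pr_set0.
  congr (Pr P _)%:E; apply/seteqP; split=> w [Sw Xw]; split => //; last first.
    by case: Sw => m _; rewrite /F; case: pickle_inv => // ? [].
  by exists n => //; rewrite /F nj.
apply/trivIsetP => n n' _ _ nn'; apply/seteqP; split => // w; rewrite /F.
case nj: pickle_inv => [j|] [//]; case nj': pickle_inv => [j'|//].
move=> [_ /= Xj] [_ /= Xj']; move: nn'.
have := @pickle_invK D n; rewrite /ocancel nj /= => <-.
by have := @pickle_invK D n'; rewrite /ocancel nj' /= => <-; rewrite -Xj -Xj' eqxx.
Qed.

Lemma Hrev_past i j : Hrev P X i j =
  Pr P ([set w | X 0 w = i] `&` [set w | X (-1) w = j]) / Pr P [set w | X 0 w = i].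
Proof.
have [_ stat _ _] := chain; rewrite /Hrev /cprob.
have := stat (-1) [:: (1, i); (0, j)]; have := stat (-1) [:: (1, i)].
by rewrite /= !cyl_cons cyl_nil !setIT subrr add0r setIC => -> ->; rewrite setIC.
Qed.

Lemma Hrev_ge0 i j : 0 <= Hrev P X i j.
Proof. by rewrite divr_ge0 ?Pr_ge0. Qed.

Lemma cP_ge0 i E : 0 <= cP i E.
Proof. by rewrite divr_ge0 ?Pr_ge0. Qed.

Lemma cP_setT i : cP i setT = 1.
Proof.
by rewrite /cP /cprob setTI divff// gt_eqF// (Pr_state_gt0 chain).
Qed.

Lemma le_cP i E F : measurable E -> measurable F -> E `<=` F -> cP i E <= cP i F.
Proof.
move=> mE mF EF; rewrite ler_wpM2r ?invr_ge0 ?Pr_ge0// le_Pr//.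
- by apply: measurableI => //; exact: mX.
- by apply: measurableI => //; exact: mX.
- exact: setSI.
Qed.

Lemma cP_le1 i E : measurable E -> cP i E <= 1.
Proof. by move=> mE; rewrite -(cP_setT i) le_cP. Qed.

Lemma cPUI i E F : measurable E -> measurable F ->
  cP i (E `|` F) + cP i (E `&` F) = cP i E + cP i F.
Proof.
move=> mE mF; rewrite /cP /cprob -!mulrDl; congr (_ / _).
set S := [set w | _]; have mS : measurable S by exact: mX.
have [mES mFS] : measurable (E `&` S) /\ measurable (F `&` S) by split; exact: measurableI.
rewrite setIUl (_ : E `&` F `&` S = (E `&` S) `&` (F `&` S)); last first.
  by rewrite setIACA setIid.
have : P ((E `&` S) `|` (F `&` S)) =
    (P (E `&` S) + P (F `&` S) - P ((E `&` S) `&` (F `&` S)))%E.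
  by apply: measureUfinr => //; rewrite ltey_eq fin_num_measure.
rewrite !PrE//; [|exact: measurableI|exact: measurableU].
by move=> [->]; rewrite subrK.
Qed.

Lemma shifted_law i B1 B2 E : measurable B1 -> measurable B2 -> measurable E ->
  (cP i (pair_event Q M (0, i) B1 B2 `&` history X Q M (-1) @^-1` E))%:E =
  (\esum_(j in [set: D])
    (Pr P (pair_event Q M (0, i) B1 B2) * (Hrev P X i j * cP j (history X Q M 0 @^-1` E)))%:E)%E.
Proof.
move=> mB1 mB2 mE; rewrite /cP /cprob.
set pe := pair_event _ _ _ _ _; set h := _ @^-1` E.
set Xi := [set w | X 0 w = i].
have mh k : measurable (history X Q M k @^-1` E).
  by apply: measurable_onset => //; exact: measurable_history.
have mpe : measurable pe by exact: measurable_pair_event.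
have mXi : measurable Xi by exact: mX.
rewrite [_ / _]mulrC EFinM Pr_total; last first.
  by apply: measurableI => //; apply: measurableI => //; exact: mh.
rewrite -esumZl ?invr_ge0 ?Pr_ge0//; last by move=> j; rewrite lee_fin Pr_ge0.
apply: eq_esum => j _; rewrite -EFinM; congr EFin.
rewrite (_ : _ `&` _ = Xi `&` [set w | X (-1) w = j] `&` pe `&` h); last first.
  by apply/seteqP; split => w /= [] => [[[? ?] ?] ?|[[? ?] ?] ?].
rewrite one_step_law// Hrev_past -/Xi -/pe (setIC _ [set w | X 0 w = j]).
ring.
Qed.

End OneStep.

(** * The shifted history and its independence of the current pair *)

Section ShiftedHistory.
Context d (T : measurableType d) (R : realType) (P : probability T R) (D : countType).
Variables (X : int -> T -> D) (Q M : int -> D -> T -> R).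
Hypothesis chain : stationary_irreducible_markov_chain P X.
Hypothesis mQM : pairs_measurable Q M.
Hypothesis indep : pairs_independent_of_chain P X Q M.
Hypothesis ident : pairs_identically_distributed P Q M.

Let mX : markov_events_measurable X. Proof. by case: chain. Qed.

Let mh (k : int) : measurable_fun setT (history X Q M k).
Proof. exact: measurable_history. Qed.

(** [now] and [before] are both conditional on X_0 = i; they test the same set of paths on the
    histories seen from times 0 and -1. *)
Definition now (i : D) (E : set mtrajectory) : R := cP P X i (history X Q M 0 @^-1` E).
Definition before (i : D) (E : set mtrajectory) : R := cP P X i (history X Q M (-1) @^-1` E).

Lemma pair_event_setT i : pair_event Q M (0, i) setT setT = setT.
Proof. by apply/seteqP; split. Qed.

(** Averaging over X_{-1}: the operator H enters here. *)
Lemma before_esum i E : measurable E ->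
  (before i E)%:E = (\esum_(j in [set: D]) (Hrev P X i j * now j E)%:E)%E.
Proof.
move=> mE; have := shifted_law chain mQM indep ident i measurableT measurableT mE.
rewrite pair_event_setT Pr_setT setTI => ->.
by apply: eq_esum => j _; rewrite mul1r.
Qed.

Lemma esum_Hrev i : (\esum_(j in [set: D]) (Hrev P X i j)%:E = 1)%E.
Proof.
have := before_esum i measurableT.
rewrite /before /now !preimage_setT (cP_setT chain) => ->.
by apply: eq_esum => j _; rewrite (cP_setT chain) mulr1.
Qed.

Lemma cP_indep i B1 B2 E : measurable B1 -> measurable B2 -> measurable E ->
  cP P X i (pair_event Q M (0, i) B1 B2 `&` history X Q M (-1) @^-1` E) =
  Pr P (pair_event Q M (0, i) B1 B2) * before i E.
Proof.
move=> mB1 mB2 mE; apply: EFin_inj.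
rewrite (shifted_law chain)// EFinM before_esum// -esumZl ?Pr_ge0//.
by move=> j; rewrite lee_fin mulr_ge0// (Hrev_ge0, cP_ge0).
Qed.

Lemma cP_Q i (B : set R) : measurable B ->
  cP P X i (Q 0 i @^-1` B) = Pr P (Q 0 i @^-1` B).
Proof.
move=> mB; have := cP_indep i mB measurableT measurableT.
rewrite /before preimage_setT (cP_setT chain) setIT mulr1.
by rewrite (_ : pair_event Q M _ _ _ = Q 0 i @^-1` B)//; apply/seteqP; split => // w [].
Qed.

(** On X_0 = i, the joint law of [M 0 i] and the shifted history agrees with a product measure on
    rectangles, hence everywhere; integrating the history out first gives the formula. *)
Lemma cP_M_history (i : D) (B : set R) (s : R -> R) (W : @mtrajectory R D -> \bar R) :
  measurable B -> measurable_fun setT s -> measurable_fun setT W ->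
  (cP P X i [set w | B (M 0 i w) /\ ((s (M 0 i w))%:E < W (history X Q M (-1) w))%E])%:E =
  (\int[P]_(w in M 0 i @^-1` B) (before i [set p : @mtrajectory R D | ((s (M 0 i w))%:E < W p)%E])%:E)%E.
Proof.
move=> mB ms mW.
pose Xi := [set w | X 0 w = i]; have mXi : measurable Xi by exact: mX.
have pi0 : 0 < Pr P Xi by exact: Pr_state_gt0.
have mM : measurable_fun setT (M 0 i) by have [] := mQM 0 i.
pose Mi : {mfun T >-> R} :=
  HB.pack (M 0 i) (isMeasurableFun.Build _ _ _ _ (M 0 i) mM).
pose m2 := restricted_law P mXi (mh (-1)).
have mMh : measurable_fun setT (fun w => (M 0 i w, history X Q M (-1) w)).
  exact/measurable_fun_pair.
pose m' := restricted_law P mXi mMh.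
pose E : set (R * mtrajectory) := [set x | B x.1 /\ ((s x.1)%:E < W x.2)%E].
have mE : measurable E.
  apply: measurableI.
    by apply: measurable_onset => //; exact: measurable_fst.
  rewrite -[X in measurable X]setTI; apply: measurable_lte => //.
    by apply/measurable_EFinP; apply: measurableT_comp => //; exact: measurable_fst.
  by apply: measurableT_comp => //; exact: measurable_snd.
have prodE : (distribution P Mi \x m2)%E E = m' E.
  apply: product_measure_unique => // A C mA mC.
  have mpe : measurable (pair_event Q M (0, i) setT A) by exact: measurable_pair_event.
  have mhC : measurable (history X Q M (-1) @^-1` C) by exact: measurable_onset.
  have := cP_indep i measurableT mA mC.
  rewrite /before /cP /cprob mulrA => /(mulIf _) h.
  move/(_ (invr_neq0 (lt0r_neq0 pi0))) in h.
  transitivity (Pr P (pair_event Q M (0, i) setT A `&` history X Q M (-1) @^-1` C `&` Xi))%:E.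
    rewrite -PrE; last by apply: measurableI => //; exact: measurableI.
    by congr (P _); apply/seteqP; split => w /= [] => [? []|[[]]].
  rewrite h EFinM -PrE// -PrE; last exact: measurableI.
  congr (P _ * P _)%E; last by rewrite setIC.
  by apply/seteqP; split => w /= => [[]|].
rewrite /cP /cprob [X in Pr P X](_ : _ = Xi `&` (fun w => (M 0 i w, history X Q M (-1) w)) @^-1` E);
  last by rewrite setIC.
have mEh : measurable (Xi `&` (fun w => (M 0 i w, history X Q M (-1) w)) @^-1` E).
  by apply: measurableI => //; exact: measurable_onset.
rewrite mulrC EFinM -PrE// -[P _]/(m' E) -prodE /product_measure1.
have mxs : measurable_fun setT (m2 \o xsection E) by exact: measurable_fun_xsection.
rewrite ge0_integral_distribution// -ge0_integralZl//; last 2 first.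
- exact: (measurableT_comp mxs).
- by rewrite lee_fin invr_ge0 ltW.
rewrite [RHS]integral_mkcond; apply: eq_integral => w _.
rewrite /patch /= /m2 /restricted_law; case: ifPn => [/set_mem/= Bw|/negP Bw].
  rewrite /before /cP /cprob mulrC EFinM; congr (_ * _)%E.
  rewrite -PrE; last first.
    apply: measurableI => //; apply: measurable_onset => //.
    rewrite -[X in measurable X]setTI; apply: measurable_lte => //.
  rewrite setIC; congr (P (_ `&` _)); apply/seteqP; split => w' /=.
    by rewrite /xsection/= inE => -[].
  by rewrite /xsection/= inE => ?; split.
rewrite (_ : xsection E _ = set0) ?preimage_set0 ?setI0 ?measure0 ?mule0//.
by apply/seteqP; split => // p; rewrite /xsection/= inE => -[Bw' _]; apply: Bw; exact/mem_set.
Qed.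

End ShiftedHistory.

(** * Limit superior under increasing affine maps *)

Section LimsupAffine.
Context {R : realType}.
Local Open Scope ereal_scope.

Lemma limn_esup_shift (u : (\bar R)^nat) : limn_esup (fun n => u n.+1) = limn_esup u.
Proof.
rewrite !limn_esup_lim; have -> : esups (fun n => u n.+1) = (fun n => esups u n.+1).
  apply/funext => n; rewrite /esups /sdrop; congr ereal_sup.
  apply/seteqP; split => _ [k /= nk <-]; first by exists k.+1.
  by case: k nk => // k nk; exists k.
by apply/cvg_lim => //; rewrite cvg_shiftS; exact: is_cvg_esups.
Qed.

Lemma lee_affine (a m : R) (x y : \bar R) : (0 < m)%R ->
  (x <= a%:E + m%:E * y) = (m^-1%:E * (x - a%:E) <= y).
Proof. by move=> m0; rewrite lee_pdivrMl// leeBlDl. Qed.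

Lemma limn_esup_affine_le (a m : R) (u : (\bar R)^nat) : (0 < m)%R ->
  limn_esup (fun n => a%:E + m%:E * u n) <= a%:E + m%:E * limn_esup u.
Proof.
move=> m0; rewrite lee_affine// /limn_esup /limf_esup.
apply: le_ereal_inf_tmp => _ [A FA <-]; rewrite -lee_affine//.
apply: (@le_trans _ _ (ereal_sup [set a%:E + m%:E * u n | n in A])).
  by apply: ereal_inf_lbound; exists A.
apply: ge_ereal_sup => _ [n An <-]; rewrite leeD2l// lee_pmul2l//.
by apply: ereal_sup_ubound; exists n.
Qed.

(** One inequality is [limn_esup_affine_le]; the other is the same lemma for the inverse affine map,
    which is again increasing because m > 0. *)
Lemma limn_esup_affine (a m : R) (u : (\bar R)^nat) : (0 < m)%R ->
  limn_esup (fun n => a%:E + m%:E * u n) = a%:E + m%:E * limn_esup u.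
Proof.
move=> m0; apply/eqP; rewrite eq_le limn_esup_affine_le//=.
have mi0 : (0 < m^-1)%R by rewrite invr_gt0.
have := limn_esup_affine_le (- (m^-1 * a)) (fun n => a%:E + m%:E * u n) mi0.
have inv x : m^-1%:E * (a%:E + m%:E * x) = (m^-1 * a)%:E + x.
  case: x => [r| |].
  - by apply: congr1 (EFin) _ _ _; rewrite mulrDr mulKf// gt_eqF.
  - by rewrite gt0_muley ?lte_fin// addey// gt0_muley ?lte_fin// addey.
  - by rewrite gt0_muleNy ?lte_fin// addeNy gt0_muleNy ?lte_fin// addeNy.
rewrite (_ : (fun n => _) = u); last first.
  apply/funext => n; rewrite inv EFinN.
  by case: (u n) => [r| |]//; apply: congr1 (EFin) _ _ _; rewrite addKr.
rewrite lee_affine// invrK EFinN oppeK => h; apply: le_trans h.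
case: (limn_esup u) => [r| |].
- by rewrite lee_fin mulrDr mulVKf ?gt_eqF// addrC.
- by rewrite gt0_muley ?lte_fin// addey// addye// gt0_muley ?lte_fin.
- by rewrite gt0_muleNy ?lte_fin// addeNy.
Qed.

End LimsupAffine.

(** * The recursion R = Q + M R' *)

Section Recursion.
Context d (T : measurableType d) (R : realType) (P : probability T R) (D : countType).
Variables (X : int -> T -> D) (Q M : int -> D -> T -> R).

Lemma history_shift w n : history X Q M 0 w n.+1 = history X Q M (-1) w n.
Proof.
rewrite /history.
by have -> : 0 - n.+1%:Z = -1 - n%:Z by rewrite sub0r -addn1 PoszD opprD addrC.
Qed.

Lemma perpetuity_shift f N k w :
  perpetuity f N k.+1 (history X Q M 0 w) = perpetuity f N k (history X Q M (-1) w).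
Proof.
elim: N k => [//|N IH] k /=; rewrite IH /along !history_shift /Q_at /M_at !history_shift//.
Qed.

Lemma perpetuity_history f N w :
  perpetuity f N.+1 0 (history X Q M 0 w) =
  f (Q 0 (X 0 w) w) + f (M 0 (X 0 w) w) * perpetuity f N 0 (history X Q M (-1) w).
Proof. by rewrite /= perpetuity_shift /along /= !subr0. Qed.

Lemma perpetuity_sum N k w :
  perpetuity id N k (history X Q M 0 w) =
  \sum_(0 <= n < N) Defs.induced X Q (- (k + n)%:Z) w *
    \prod_(0 <= l < n) Defs.induced X M (- (k + l)%:Z) w.
Proof.
elim: N k => [|N IH] k; first by rewrite big_geq.
rewrite big_nat_recl// big_geq// mulr1 addn0 /= IH /along /= /Q_at /M_at /= sub0r.
congr (_ + _); rewrite big_distrr/=; apply: eq_bigr => n _.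
rewrite big_nat_recl// addn0 mulrCA; congr (_ * _); first by rewrite addnS.
by congr (_ * _); apply: eq_bigr => l _; rewrite addnS.
Qed.

Lemma R_sol_history w : R_sol X Q M w = perpetuity_lim (history X Q M 0 w).
Proof.
rewrite /R_sol /perpetuity_lim; congr limn_esup; apply/funext => N.
by rewrite perpetuity_sum /partial_R; congr EFin; apply: eq_bigr.
Qed.

(** With the limit superior as the value of the series, the recursion is pointwise and needs no
    convergence; splitting off the first term only shifts the index. *)
Lemma perpetuity_lim_history w : 0 < M 0 (X 0 w) w ->
  perpetuity_lim (history X Q M 0 w) =
  ((Q 0 (X 0 w) w)%:E + (M 0 (X 0 w) w)%:E * perpetuity_lim (history X Q M (-1) w))%E.
Proof.
move=> M0; rewrite {2}/perpetuity_lim.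
rewrite (limn_esup_shift (fun N => (perpetuity id N 0 (history X Q M (-1) w))%:E)).
rewrite -limn_esup_affine//; congr limn_esup; apply/funext => N.
by rewrite perpetuity_history.
Qed.

Lemma perpetuity_norm_ge0 N k (p : @mtrajectory R D) : 0 <= perpetuity Num.norm N k p.
Proof.
elim: N k => [//|N IH] k /=; rewrite addr_ge0 ?mulr_ge0// /along.
- by case: (p k).1.
- by case: (p k).1.
Qed.

Lemma norm_perpetuity_le N k (p : @mtrajectory R D) :
  `|perpetuity id N k p| <= perpetuity Num.norm N k p.
Proof.
elim: N k => [|N IH] k /=; first by rewrite normr0.
apply: le_trans (ler_normD _ _) _; rewrite normrM lerD//.
  by rewrite /along; case: (p k).1 => //; rewrite normr0.
rewrite ler_pM//; last by rewrite /along; case: (p k).1 => //; rewrite normr0.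
Qed.

(** If all sums of absolute values stay below s, the partial sums stay in [-s, s], and so does their
    limit superior. Bounds uniform in N thus pass to the limit. *)
Lemma perpetuity_lim_le (p : @mtrajectory R D) (s : R) :
  (s%:E < `|perpetuity_lim p|)%E -> exists N, s < perpetuity Num.norm N 0 p.
Proof.
move=> sp; apply: contrapT => /forallNP h.
have {}h N : perpetuity Num.norm N 0 p <= s by rewrite leNgt; apply/negP; exact: h.
have {}h N : - s <= perpetuity id N 0 p <= s.
  by rewrite -ler_norml (le_trans (norm_perpetuity_le _ _ _)).
have Ls : (perpetuity_lim p <= s%:E)%E.
  apply: (@le_trans _ _ (ereal_sup [set (perpetuity id N.+1 0 p)%:E | N in setT])).
    by apply: ereal_inf_lbound; exists setT => //; exact: filterT.
  by apply: ge_ereal_sup => _ [N _ <-]; rewrite lee_fin; case/andP: (h N.+1).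
have sL : ((- s)%:E <= perpetuity_lim p)%E.
  apply: le_ereal_inf_tmp => _ [A FA <-].
  have [N AN] : A !=set0 by apply: filter_ex FA.
  apply: (@le_trans _ _ (perpetuity id N.+1 0 p)%:E).
    by rewrite lee_fin; case/andP: (h N.+1).
  by apply: ereal_sup_ubound; exists N.
move: Ls sL sp; case: (perpetuity_lim p) => [r| |] //.
by rewrite !lee_fin lte_fin ltNge ler_norml => -> ->.
Qed.

End Recursion.

(** * One-step tail inequalities *)

Section TailInequalities.
Context d (T : measurableType d) (R : realType) (P : probability T R) (D : countType).
Variables (X : int -> T -> D) (Q M : int -> D -> T -> R).
Hypothesis chain : stationary_irreducible_markov_chain P X.
Hypothesis mQM : pairs_measurable Q M.
Hypothesis indep : pairs_independent_of_chain P X Q M.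
Hypothesis ident : pairs_identically_distributed P Q M.
Hypothesis M_gt0 : forall i, Pr P [set w | 0 < M 0 i w] = 1.

Let mX : markov_events_measurable X. Proof. by case: chain. Qed.
Let mQ i : measurable_fun setT (Q 0 i). Proof. by case: (mQM 0 i). Qed.
Let mM i : measurable_fun setT (M 0 i). Proof. by case: (mQM 0 i). Qed.
Let mh (k : int) : measurable_fun setT (history X Q M k).
Proof. exact: measurable_history. Qed.

Local Notation cP := (cP P X).
Local Notation now := (now P X Q M).
Local Notation before := (before P X Q M).

Definition tail (W : @mtrajectory R D -> \bar R) (t : R) : set mtrajectory := [set p | (t%:E < W p)%E].

Lemma measurable_tail W t : measurable_fun setT W -> measurable (tail W t).
Proof.
by move=> mW; rewrite /tail -[X in measurable X]setTI; apply: measurable_lte.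
Qed.

Definition M_above i (A : R) : set T := [set w | A < M 0 i w].

Lemma measurable_M_above i A : measurable (M_above i A).
Proof. by rewrite /M_above -[X in measurable X]setTI; apply: measurable_fun_ltr => //. Qed.

Lemma measurable_before_tail W i : measurable_fun setT W ->
  measurable_fun setT (fun t => before i (tail W t)).
Proof.
move=> mW; apply: nonincreasing_measurable => // s t st.
apply: le_cP => //.
- by apply: measurable_onset => //; exact: measurable_tail.
- by apply: measurable_onset => //; exact: measurable_tail.
- by move=> w /=; apply: le_lt_trans; rewrite lee_fin.
Qed.

Lemma before_ge0 i E : 0 <= before i E. Proof. exact: cP_ge0. Qed.

Lemma before_le1 i E : measurable E -> before i E <= 1.
Proof. by move=> mE; apply: cP_le1 => //; exact: measurable_onset. Qed.

Lemma now_ge0 i E : 0 <= now i E. Proof. exact: cP_ge0. Qed.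

Lemma now_le1 i E : measurable E -> now i E <= 1.
Proof. by move=> mE; apply: cP_le1 => //; exact: measurable_onset. Qed.

(** The event M_{0,i} <= 0 is null, so an inclusion need only be checked where M is positive. *)
Lemma le_cP_pos i E F : measurable E -> measurable F ->
  (forall w, X 0 w = i -> 0 < M 0 i w -> E w -> F w) -> cP i E <= cP i F.
Proof.
move=> mE mF EF; rewrite ler_wpM2r ?invr_ge0 ?Pr_ge0//.
set Xi := [set w | _]; have mXi : measurable Xi by exact: mX.
have mC : measurable (~` M_above i 0) by apply: measurableC; exact: measurable_M_above.
have C0 : P (~` M_above i 0) = 0%E.
  rewrite probability_setC ?PrE ?M_gt0 ?subee//; exact: measurable_M_above.
rewrite -lee_fin -!PrE; [|exact: measurableI..].
apply: (@le_trans _ _ (P ((F `&` Xi) `|` ~` M_above i 0))).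
  apply: le_measure; rewrite ?inE; [exact: measurableI| |].
    by apply: measurableU => //; exact: measurableI.
  move=> w [Ew Xw]; have [M0|M0] := ltP 0 (M 0 i w).
    by left; split => //; exact: EF.
  by right => /=; apply/negP; rewrite -leNgt.
have h : (P ((F `&` Xi) `|` ~` M_above i 0) <= P (F `&` Xi) + P (~` M_above i 0))%E.
  by apply: measureU2 => //; exact: measurableI.
by apply: le_trans h _; rewrite C0 adde0.
Qed.

Lemma cPU_le i E F : measurable E -> measurable F -> cP i (E `|` F) <= cP i E + cP i F.
Proof.
by move=> mE mF; rewrite -cPUI// lerDl cP_ge0.
Qed.

Lemma M_tail i W A t : 0 <= A -> measurable_fun setT W ->
  cP i [set w | A < M 0 i w /\ ((t / M 0 i w)%:E < W (history X Q M (-1) w))%E] =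
  \int[P]_(w in M_above i A) before i (tail W (t / M 0 i w)).
Proof.
move=> A0 mW.
(* The power with exponent -1 is measurable on the whole line and equals the inverse where m > A >=
   0. *)
have ms : measurable_fun setT (fun m : R => t * m `^ (-1)).
  by apply: measurable_funM => //; exact: measurable_powR.
have := @cP_M_history _ _ _ P _ X Q M chain mQM indep ident i [set m | A < m] _ W _ ms mW.
move=> h; rewrite /Rintegral.
have <- : (\int[P]_(w in M 0 i @^-1` [set m | (A < m)%R])
    (before i [set p | ((t * M 0 i w `^ (-1))%:E < W p)%E])%:E)%E =
  (\int[P]_(w in M_above i A) (before i (tail W (t / M 0 i w)))%:E)%E.
  apply: eq_integral => w; rewrite inE /= => Aw.
  by rewrite powR_inv1// ltW// (le_lt_trans A0).
rewrite -h /=.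
  congr (cP _ _); apply/seteqP; split => w /= [Aw].
    by rewrite powR_inv1// ltW// (le_lt_trans A0).
  by rewrite powR_inv1// ltW// (le_lt_trans A0).
by rewrite -[X in measurable X]setTI; apply: measurable_fun_ltr => //.
Qed.

Let mtailh (W : @mtrajectory R D -> \bar R) k t : measurable_fun setT W ->
  measurable [set w | (t%:E < W (history X Q M k w))%E].
Proof.
move=> mW; apply: (measurable_onset (f := history X Q M k) (B := tail W t)) => //.
exact: measurable_tail.
Qed.

Let mMtailh (W : @mtrajectory R D -> \bar R) i A t : measurable_fun setT W ->
  measurable [set w | A < M 0 i w /\ ((t * M 0 i w `^ (-1))%:E < W (history X Q M (-1) w))%E].
Proof.
move=> mW; apply: measurableI; first exact: measurable_M_above.
rewrite -[X in measurable X]setTI; apply: measurable_lte => //.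
  apply/measurable_EFinP; apply: measurable_funM => //.
  exact: (measurableT_comp (measurable_powR (-1)) (mM i)).
exact: measurableT_comp.
Qed.

Let Mtail_set (W : @mtrajectory R D -> \bar R) i A t : 0 <= A ->
  [set w | A < M 0 i w /\ ((t / M 0 i w)%:E < W (history X Q M (-1) w))%E] =
  [set w | A < M 0 i w /\ ((t * M 0 i w `^ (-1))%:E < W (history X Q M (-1) w))%E].
Proof.
move=> A0; apply/seteqP; split => w /= [Aw];
  by rewrite powR_inv1// ltW// (le_lt_trans A0).
Qed.

Let mQgt i t : measurable [set w | t < Q 0 i w].
Proof. by rewrite -[X in measurable X]setTI; apply: measurable_fun_ltr. Qed.

Let mQabs i t : measurable [set w | t < `|Q 0 i w|].
Proof.
rewrite -[X in measurable X]setTI; apply: measurable_fun_ltr => //.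
exact: measurableT_comp.
Qed.

Definition abs_perpetuity N (p : @mtrajectory R D) : \bar R := (perpetuity Num.norm N 0 p)%:E.

Lemma measurable_abs_perpetuity N : measurable_fun setT (abs_perpetuity N).
Proof. by apply/measurable_EFinP; apply: measurable_perpetuity. Qed.

(** If |Q| + M S > t for the shifted sum S, then |Q| > e t or M S > (1 - e) t. *)
Lemma now_abs_perpetuity_le N i e t :
  now i (tail (abs_perpetuity N.+1) t) <=
  Pr P [set w | e * t < `|Q 0 i w|] +
  \int[P]_(w in M_above i 0) before i (tail (abs_perpetuity N) ((1 - e) * t / M 0 i w)).
Proof.
have mN := measurable_abs_perpetuity.
rewrite -M_tail// -(cP_Q chain mQM indep ident i (B := [set q | e * t < `|q|])); last first.
  by rewrite -[X in measurable X]setTI; apply: measurable_fun_ltr.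
have mMt := mMtailh i 0 ((1 - e) * t) (mN N).
rewrite -Mtail_set// in mMt.
apply: le_trans (cPU_le _ _ _); [|exact: mQabs|exact: mMt].
apply: le_cP_pos; [exact: mtailh|by apply: measurableU => //; exact: mQabs|].
move=> w Xw M0; rewrite /= /tail /= /abs_perpetuity lte_fin perpetuity_history Xw.
rewrite (gtr0_norm M0) => h; have [?|hQ] := ltP (e * t) `|Q 0 i w|; first by left.
by right; split => //; rewrite lte_fin ltr_pdivrMr// mulrC; lra.
Qed.

Lemma perpetuity_norm_homo N k (p : @mtrajectory R D) :
  perpetuity Num.norm N k p <= perpetuity Num.norm N.+1 k p.
Proof.
elim: N k => [|N IH] k; first exact: perpetuity_norm_ge0.
rewrite [leRHS]/= [leLHS]/= lerD2l; apply: ler_wpM2l; last exact: IH.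
by rewrite /along; case: (p k).1.
Qed.

Definition abs_lim (p : @mtrajectory R D) : \bar R := `|perpetuity_lim p|%E.

Lemma measurable_abs_lim : measurable_fun setT abs_lim.
Proof. by apply: measurableT_comp => //; exact: measurable_perpetuity_lim. Qed.

(** The tail events of the absolute sums increase with N and their union contains the tail event of
    |R|; continuity from below concludes. *)
Lemma now_abs_lim_le i s C : (forall N, now i (tail (abs_perpetuity N) s) <= C) ->
  now i (tail abs_lim s) <= C.
Proof.
move=> CN; set Xi := [set w | X 0 w = i]; have mXi : measurable Xi by exact: mX.
have pi0 : 0 < Pr P Xi by exact: Pr_state_gt0.
pose F N := history X Q M 0 @^-1` tail (abs_perpetuity N) s `&` Xi.
have mF N : measurable (F N).
  apply: measurableI => //; apply: measurable_onset => //.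
  exact: measurable_tail (measurable_abs_perpetuity N).
have mUF : measurable (\bigcup_N F N) by exact: bigcupT_measurable.
have mL : measurable (history X Q M 0 @^-1` tail abs_lim s `&` Xi).
  apply: measurableI => //; apply: measurable_onset => //.
  exact: measurable_tail measurable_abs_lim.
rewrite /now /cP /cprob ler_pdivrMr//.
apply: (@le_trans _ _ (Pr P (\bigcup_N F N))).
  apply: le_Pr => // w [/= /perpetuity_lim_le[N sN] Xw].
  by exists N => //; split => //=; rewrite /tail/= lte_fin.
have ndF : nondecreasing_seq F.
  apply/nondecreasing_seqP => N; apply/subsetPset => w [/= sN Xw]; split => //=.
  apply: lt_le_trans sN _; rewrite lee_fin; exact: perpetuity_norm_homo.
have cvgF : P (F N) @[N --> \oo] --> P (\bigcup_N F N).
  exact: nondecreasing_cvg_mu.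
rewrite -lee_fin -PrE// -(cvg_lim _ cvgF)//; apply: lime_le.
  by apply/cvg_ex; exists (P (\bigcup_N F N)).
apply: nearW => N; rewrite PrE// lee_fin -ler_pdivrMr//; exact: CN.
Qed.

(** For M > 0 the second condition reads M |R'| > e t, so both summands of R are large. *)
Definition big_both i (e t : R) : set T :=
  [set w | e * t < `|Q 0 i w| /\
    ((e * t / M 0 i w)%:E < abs_lim (history X Q M (-1) w))%E].

Let mbig i e t : measurable (M_above i 0 `&` big_both i e t).
Proof.
have := mMtailh i 0 (e * t) measurable_abs_lim; rewrite -Mtail_set// => m1.
rewrite (_ : _ `&` _ = [set w | e * t < `|Q 0 i w|] `&`
  [set w | 0 < M 0 i w /\
    ((e * t / M 0 i w)%:E < abs_lim (history X Q M (-1) w))%E]).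
  by apply: measurableI.
by apply/seteqP; split => w [? []].
Qed.

Definition joint_tail i e t := cP i (M_above i 0 `&` big_both i e t).

(** When the sum exceeds t and neither summand exceeds (1 - e) t, each of them is at least e t,
    hence beyond e t / 2. *)
Lemma now_lim_le i e t : 0 < e < 1 -> 0 < t ->
  now i (tail perpetuity_lim t) <=
  Pr P [set w | (1 - e) * t < Q 0 i w] +
  \int[P]_(w in M_above i 0) before i (tail perpetuity_lim ((1 - e) * t / M 0 i w)) +
  joint_tail i (e / 2) t.
Proof.
move=> /andP[e0 e1] t0; have mW := @measurable_perpetuity_lim R D.
rewrite -M_tail// -(cP_Q chain mQM indep ident i (B := [set q | (1 - e) * t < q])); last first.
  by rewrite -[X in measurable X]setTI; apply: measurable_fun_ltr.
have mMt := mMtailh i 0 ((1 - e) * t) mW; rewrite -Mtail_set// in mMt.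
apply: le_trans (lerD (cPU_le _ _ _) (lexx _)); [|exact: mQgt|exact: mMt].
apply: le_trans (cPU_le _ _ _); [|by apply: measurableU => //; exact: mQgt|exact: mbig].
apply: le_cP_pos; [exact: mtailh| |].
  by apply: measurableU; [apply: measurableU => //; exact: mQgt|exact: mbig].
move=> w Xw M0; rewrite /= /tail /= perpetuity_lim_history ?Xw// /big_both /M_above /=.
rewrite /abs_lim; have et : 0 < e * t by rewrite mulr_gt0.
case: (perpetuity_lim _) => [r| |] h.
- have [?|hQ] := ltP ((1 - e) * t) (Q 0 i w); first by left; left.
  have [hr|hr] := ltP ((1 - e) * t / M 0 i w) r; first by left; right.
  right; move: h; rewrite -EFinM -EFinD !lte_fin => h.
  have Mr : M 0 i w * r <= (1 - e) * t by rewrite mulrC -ler_pdivlMr.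
  split => //; split; first by apply: lt_le_trans (ler_norm _); lra.
  rewrite ltr_pdivrMr//; apply: (@lt_le_trans _ _ (r * M 0 i w)).
    by rewrite mulrC; lra.
  by rewrite ler_pM2r// ler_norm.
- by left; right; rewrite ltry.
- by move: h; rewrite gt0_muleNy ?lte_fin.
Qed.

(** The two probabilities add up to those of the union and the intersection. On the union, R > t
    unless the other summand is below -e t, a case of both being large; on the intersection both are
    large. Hence the factor 2. *)
Lemma now_lim_ge i e t : 0 < e < 1 -> 0 < t ->
  Pr P [set w | (1 + e) * t < Q 0 i w] +
  \int[P]_(w in M_above i 0) before i (tail perpetuity_lim ((1 + e) * t / M 0 i w)) <=
  now i (tail perpetuity_lim t) + 2 * joint_tail i (e / 2) t.
Proof.
move=> /andP[e0 e1] t0; have mW := @measurable_perpetuity_lim R D.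
rewrite -M_tail// -(cP_Q chain mQM indep ident i (B := [set q | (1 + e) * t < q])); last first.
  by rewrite -[X in measurable X]setTI; apply: measurable_fun_ltr.
have mMt := mMtailh i 0 ((1 + e) * t) mW; rewrite -Mtail_set// in mMt.
rewrite -(cPUI chain i (mQgt i ((1 + e) * t)) mMt).
rewrite (_ : 2 * _ = joint_tail i (e / 2) t + joint_tail i (e / 2) t); last by ring.
have et : 0 < e * t by rewrite mulr_gt0.
rewrite addrA; apply: lerD.
  apply: le_trans (cPU_le _ _ _); [|exact: mtailh|exact: mbig].
  apply: le_cP_pos; [by apply: measurableU => //; exact: mQgt| |].
    by apply: measurableU; [exact: mtailh|exact: mbig].
  move=> w Xw M0; rewrite /= /tail /= perpetuity_lim_history ?Xw// /big_both /M_above /=.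
  rewrite /abs_lim; case: (perpetuity_lim _) => [r| |] h.
  - rewrite -EFinM -EFinD /= !lte_fin.
    have [?|hQ] := ltP t (Q 0 i w + M 0 i w * r); first by left.
    right; split => //; case: h => [h|[_]].
      split; first by apply: lt_le_trans (ler_norm _); lra.
      rewrite ltr_pdivrMr//; apply: (@lt_le_trans _ _ (- r * M 0 i w)).
        by rewrite mulNr mulrC; lra.
      by rewrite ler_pM2r// -normrN ler_norm.
    rewrite lte_fin ltr_pdivrMr// mulrC => h.
    split; first by rewrite -normrN; apply: lt_le_trans (ler_norm _); lra.
    rewrite ltr_pdivrMr//; apply: (@lt_le_trans _ _ (r * M 0 i w)).
      by rewrite mulrC; lra.
    by rewrite ler_pM2r// ler_norm.
  - by left; rewrite gt0_muley ?lte_fin// addey// ltry.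
  - right; split => //; split; last by rewrite ltry.
    case: h => [h|[_]]; first by apply: lt_le_trans (ler_norm _); lra.
    by rewrite ltNge leNye.
apply: le_cP_pos; [by apply: measurableI => //; exact: mQgt|exact: mbig|].
move=> w Xw M0 [/= hQ [_ hW]]; split => //; split.
  by apply: lt_le_trans (ler_norm _); lra.
rewrite /abs_lim; apply: lt_le_trans (lee_abs _); apply: le_lt_trans hW.
by rewrite lee_fin ler_pM2r ?invr_gt0//; lra.
Qed.

(** For M <= A the second condition implies |R'| > e t / A, which is independent of Q and gives the
    product; for M > A the condition on Q is dropped. *)
Lemma joint_tail_le i e t A : 0 < A -> 0 < e -> 0 < t ->
  joint_tail i e t <=
  Pr P [set w | e * t < `|Q 0 i w|] * before i (tail abs_lim (e * t / A)) +
  \int[P]_(w in M_above i A) before i (tail abs_lim (e * t / M 0 i w)).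
Proof.
move=> A0 e0 t0; have mW := measurable_abs_lim.
rewrite -M_tail//; last exact: ltW.
have mB : measurable [set q : R | e * t < `|q|].
  rewrite -[X in measurable X]setTI; apply: measurable_fun_ltr => //.
have mt := measurable_tail (e * t / A) mW.
have := cP_indep chain mQM indep ident i mB measurableT mt.
rewrite (_ : pair_event _ _ _ _ _ = [set w | e * t < `|Q 0 i w|]); last first.
  by apply/seteqP; split => // w [].
move=> <-; have mMt := mMtailh i A (e * t) mW.
rewrite -Mtail_set// in mMt; last exact: ltW.
have mI : measurable ([set w | e * t < `|Q 0 i w|] `&`
    history X Q M (-1) @^-1` tail abs_lim (e * t / A)).
  by apply: measurableI; [exact: mQabs|exact: measurable_onset].
apply: le_trans (cPU_le _ _ _) => //; apply: le_cP_pos => //; first exact: measurableU.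
move=> w _ M0 [_ [hQ hW]]; have [AM|MA] := ltP A (M 0 i w); first by right.
left; split => //=; rewrite /tail/=; apply: le_lt_trans hW.
by rewrite lee_fin ler_pM2l ?mulr_gt0// lef_pV2.
Qed.

End TailInequalities.

(** * Averages with probability weights *)

Section Averaging.
Context {R : realType} {D : countType}.
Variable a : D -> R.
Hypothesis a_ge0 : forall j, 0 <= a j.
Hypothesis a_sum1 : (\esum_(j in [set: D]) (a j)%:E = 1)%E.

Lemma esum_weight_cst (b : R) : 0 <= b -> (\esum_(j in [set: D]) (a j * b)%:E = b%:E)%E.
Proof.
move=> b0; transitivity (\esum_(j in [set: D]) (b%:E * (a j)%:E))%E.
  by apply: eq_esum => j _; rewrite -EFinM mulrC.
by rewrite esumZl ?a_sum1 ?mule1// => j; rewrite lee_fin.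
Qed.

Lemma esum_weight_fin (u : D -> R) (b : R) : (forall j, 0 <= u j <= b) ->
  (\esum_(j in [set: D]) (a j * u j)%:E)%E \is a fin_num.
Proof.
move=> ub; have [j0|noD] := pselect (inhabited D); last first.
  rewrite esum1// => j; exfalso; apply: noD; exact: inhabits.
have b0 : 0 <= b by case: j0 => j; have /andP[] := ub j; exact: le_trans.
rewrite ge0_fin_numE; last first.
  by apply: esum_ge0 => j _; rewrite lee_fin mulr_ge0//; case/andP: (ub j).
apply: le_lt_trans (ltry b); rewrite -esum_weight_cst//.
apply: le_esum => j _; rewrite lee_fin ler_wpM2l//; by case/andP: (ub j).
Qed.

Lemma esum_weight_le (u v : D -> R) (x y : R) :
  (x%:E = \esum_(j in [set: D]) (a j * u j)%:E)%E ->
  (y%:E = \esum_(j in [set: D]) (a j * v j)%:E)%E ->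
  (forall j, u j <= v j) -> x <= y.
Proof.
move=> xE yE uv; rewrite -lee_fin xE yE; apply: le_esum => j _.
by rewrite lee_fin ler_wpM2l.
Qed.

Lemma esum_weight_affine (u : D -> R) (x b c : R) : 0 <= b -> 0 <= c ->
  (forall j, 0 <= u j) ->
  (x%:E = \esum_(j in [set: D]) (a j * u j)%:E)%E ->
  ((b * x + c)%:E = \esum_(j in [set: D]) (a j * (b * u j + c))%:E)%E.
Proof.
move=> b0 c0 u0 xE; rewrite EFinD EFinM xE -(esum_weight_cst c0).
rewrite -esumZl//; last by move=> j; rewrite lee_fin mulr_ge0.
rewrite -esumD.
- by apply: eq_esum => j _; rewrite -EFinM -EFinD; congr EFin; ring.
- by move=> j _; rewrite mule_ge0 ?lee_fin// mulr_ge0.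
- by move=> j _; rewrite lee_fin mulr_ge0.
Qed.

Variables (K : D -> R) (k : R).
Hypothesis k_ge0 : 0 <= k.
Hypothesis K_le : forall j, `|K j| <= k.

(** The sum of a_j K_j for a signed K bounded by k: the shift by k makes the terms nonnegative, and
    since the weights have total mass 1 it is undone by subtracting k. *)
Definition average : R := fine (\esum_(j in [set: D]) (a j * (K j + k))%:E)%E - k.

Let Kk j : 0 <= K j + k <= 2 * k.
Proof. by have := K_le j; rewrite ler_norml => /andP[? ?]; apply/andP; split; lra. Qed.

Let Kk_ge0 j : 0 <= K j + k. Proof. by case/andP: (Kk j). Qed.

Let averageE : (average + k)%:E = (\esum_(j in [set: D]) (a j * (K j + k))%:E)%E.
Proof. by rewrite /average subrK fineK//; apply: esum_weight_fin Kk. Qed.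

Lemma norm_average_le : `|average| <= k.
Proof.
have h1 : 0 <= average + k.
  rewrite -lee_fin averageE; apply: esum_ge0 => j _; rewrite lee_fin mulr_ge0//.
have h2 : average + k <= 2 * k.
  have k2 : 0 <= 2 * k by rewrite mulr_ge0.
  apply: (esum_weight_le averageE (esym (esum_weight_cst k2))) => j.
  by case/andP: (Kk j).
by rewrite ler_norml; apply/andP; split; lra.
Qed.

(** Positive minus negative parts, and m times [average], are both the difference of the summable
    families m a (K + k) and m a k. *)
Lemma csum_average (m : R) : 0 <= m -> csum (fun j => m * a j * K j) = m * average.
Proof.
move=> m0; pose f j := (m * (a j * (K j + k)))%:E; pose g j := (m * (a j * k))%:E.
have f0 j : (0 <= f j)%E by rewrite lee_fin !mulr_ge0.
have g0 j : (0 <= g j)%E by rewrite lee_fin !mulr_ge0.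
have fE : (\esum_(j in [set: D]) f j = (m * (average + k))%:E)%E.
  by rewrite EFinM averageE -esumZl// => j; rewrite lee_fin mulr_ge0.
have gE : (\esum_(j in [set: D]) g j = (m * k)%:E)%E.
  rewrite EFinM -(esum_weight_cst k_ge0) -esumZl// => j.
  by rewrite lee_fin mulr_ge0.
have sf : summable setT f.
  by rewrite /summable (eq_esum (b := f)) ?fE ?ltry// => j _; rewrite gee0_abs.
have sg : summable setT g.
  by rewrite /summable (eq_esum (b := g)) ?gE ?ltry// => j _; rewrite gee0_abs.
have := esumB sf sg (fun j _ => f0 j) (fun j _ => g0 j).
have sfg := summableB sf sg.
rewrite fE gE /csum.
have posE : (\esum_(j in [set: D]) (f \- g)^\+ j =
    \esum_(j in [set: D]) (Num.max (m * a j * K j) 0)%:E)%E.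
  apply: eq_esum => j _; rewrite funeposE /f /g -EFinB -EFin_max; congr (Num.max _ _)%:E.
  ring.
have negE : (\esum_(j in [set: D]) (f \- g)^\- j =
    \esum_(j in [set: D]) (Num.max (- (m * a j * K j)) 0)%:E)%E.
  apply: eq_esum => j _; rewrite funenegE /f /g -EFinB -EFinN -EFin_max.
  congr (Num.max _ _)%:E; ring.
rewrite posE negE => h.
have := congr1 fine h; rewrite fineB.
- by move=> ->; rewrite -EFinB /=; ring.
- rewrite -posE (eq_esum (b := (abse \o (f \- g)^\+)%E)) -?summableE; first exact: summable_funepos.
  by move=> j _ /=; rewrite gee0_abs.
- rewrite -negE (eq_esum (b := (abse \o (f \- g)^\-)%E)) -?summableE; first exact: summable_funeneg.
  by move=> j _ /=; rewrite gee0_abs.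
Qed.

(** A uniform error survives averaging. As K may be signed, u and K y are first shifted by k y (and
    by e), so that only sums of nonnegative terms are compared. *)
Lemma average_approx (u : D -> R) (x y e : R) : 0 <= y -> (forall j, 0 <= u j) ->
  (x%:E = \esum_(j in [set: D]) (a j * u j)%:E)%E ->
  (forall j, `|u j - K j * y| <= e) -> `|x - average * y| <= e.
Proof.
move=> y0 u0 xE ue; have [j0|noD] := pselect (inhabited D); last first.
  have := a_sum1; rewrite esum1; first by move=> /esym/eqP; rewrite onee_eq0.
  by move=> j; exfalso; apply: noD; exact: inhabits.
have e0 : 0 <= e by case: j0 => j; apply: le_trans (ue j).
have ky0 : 0 <= k * y by rewrite mulr_ge0.
have u1 := esum_weight_affine ler01 ky0 u0 xE.
have u2 := esum_weight_affine ler01 (addr_ge0 ky0 e0) u0 xE.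
have v1 := esum_weight_affine y0 (lexx 0) Kk_ge0 averageE.
have v2 := esum_weight_affine y0 e0 Kk_ge0 averageE.
have ue' j : u j - K j * y <= e /\ - e <= u j - K j * y.
  by have := ue j; rewrite ler_norml => /andP[].
have h1 := esum_weight_le u1 v2 (fun j => ltac:(have [] := ue' j; lra)).
have h2 := esum_weight_le v1 u2 (fun j => ltac:(have [] := ue' j; lra)).
by rewrite ler_norml; apply/andP; split; lra.
Qed.

Lemma average_ge (j : D) : (forall l, 0 <= K l) -> a j * K j <= average.
Proof.
move=> K0; rewrite /average lerBrDr -lee_fin -/(average) fineK; last exact: esum_weight_fin Kk.
rewrite addrC EFinD -(esum_weight_cst k_ge0).
have -> : (a j * K j)%:E = (\esum_(l in [set j]) (a l * K l)%:E)%E.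
  by rewrite esum_set1// lee_fin mulr_ge0.
rewrite (esum_mkcond [set j]) -esumD.
- apply: le_esum => l _; case: ifPn => _; rewrite -EFinD lee_fin.
    by rewrite mulrDr addrC.
  by rewrite addr0 ler_wpM2l// lerDr.
- by move=> l _; rewrite lee_fin mulr_ge0.
- by move=> l _; case: ifPn => // _; rewrite lee_fin mulr_ge0.
Qed.

End Averaging.

(** * Moments of M and integrals of scaled tails *)

Section Moments.
Context d (T : measurableType d) (R : realType) (P : probability T R).
Variables (Y : T -> R) (al b C : R).
Hypothesis mY : measurable_fun setT Y.
Hypotheses (al_gt0 : 0 < al) (al_b : al < b).
Hypothesis Y_moment : (\int[P]_w (`|Y w| `^ b)%:E <= C%:E)%E.

Local Notation above A := [set w | A < Y w].

Lemma measurable_above A : measurable (above A).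
Proof. by rewrite -[X in measurable X]setTI; apply: measurable_fun_ltr. Qed.

Lemma integrable_powR A : 0 <= A ->
  P.-integrable (above A) (EFin \o (fun w => Y w `^ b)).
Proof.
move=> A0; have mA := measurable_above A.
have mp : measurable_fun setT (fun w => `|Y w| `^ b).
  by apply: (measurableT_comp (measurable_powR b)); exact: measurableT_comp.
apply: (@eq_integrable _ _ _ P _ mA (EFin \o (fun w => `|Y w| `^ b))).
  by move=> w; rewrite inE /= => Aw; rewrite gtr0_norm// (le_lt_trans A0).
apply: (integrableS measurableT) => //.
apply/integrableP; split; first exact/measurable_EFinP.
apply: le_lt_trans (ltry C); apply: le_trans Y_moment.
rewrite le_eqVlt; apply/orP; left; apply/eqP; apply: eq_integral => w _ /=.
by rewrite ger0_norm// powR_ge0.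
Qed.

Lemma Rintegral_powR_le A : 0 <= A -> \int[P]_(w in above A) (Y w `^ b) <= C.
Proof.
move=> A0; have mA := measurable_above A.
have mp : measurable_fun setT (fun w => `|Y w| `^ b).
  by apply: (measurableT_comp (measurable_powR b)); exact: measurableT_comp.
rewrite -lee_fin fineK; last exact: integrable_fin_num (integrable_powR A0).
apply: le_trans Y_moment.
rewrite (eq_integral (fun w => (`|Y w| `^ b)%:E)); last first.
  by move=> w; rewrite inE /= => Aw; rewrite gtr0_norm// (le_lt_trans A0).
by apply: ge0_subset_integral => //; exact/measurable_EFinP.
Qed.

Lemma moment_ge0 : 0 <= C.
Proof.
apply: le_trans (Rintegral_powR_le (lexx 0)).
by apply: Rintegral_ge0 => w _; exact: powR_ge0.
Qed.

Lemma integrable_bounded (h : T -> R) A B : measurable_fun (above A) h ->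
  (forall w, A < Y w -> `|h w| <= B) -> P.-integrable (above A) (EFin \o h).
Proof.
move=> mh hB; have mA := measurable_above A.
apply: (@le_integrable _ _ _ P _ mA _ (cst B%:E)) => //.
- exact/measurable_EFinP.
- by move=> w Aw /=; rewrite lee_fin (le_trans (hB _ Aw))// ler_norm.
- by apply: finite_measure_integrable_cst.
Qed.

Lemma integrable_powR_low A : 0 <= A ->
  P.-integrable (above A) (EFin \o (fun w => Y w `^ al)).
Proof.
move=> A0; have mA := measurable_above A.
apply: (@le_integrable _ _ _ P _ mA _ (EFin \o (fun w => 1 + Y w `^ b))) => //.
- apply/measurable_EFinP; apply: measurable_funS (measurableT_comp (measurable_powR al) mY) => //.
- move=> w Aw /=; rewrite lee_fin !ger0_norm ?addr_ge0 ?powR_ge0//.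
  have Y0 : 0 <= Y w by rewrite (le_trans A0) ?ltW.
  have [Y1|Y1] := leP 1 (Y w).
    by rewrite (le_trans (ler_powR Y1 (ltW al_b)))// lerDr.
  apply: (@le_trans _ _ 1); last by rewrite lerDl powR_ge0.
  have <- : (1 : R) `^ al = 1 by rewrite powR1.
  by apply: ge0_ler_powR; rewrite ?nnegrE ?(ltW al_gt0) ?Y0 ?(ltW Y1).
- apply: (@integrableD _ _ _ P _ mA (cst 1%:E) (EFin \o (fun w => Y w `^ b))).
    exact: finite_measure_integrable_cst.
  exact: integrable_powR.
Qed.

Lemma measurable_scaled (h : R -> R) t A : 0 <= A -> measurable_fun setT h ->
  measurable_fun (above A) (fun w => h (t / Y w)).
Proof.
move=> A0 mh; apply: (eq_measurable_fun (fun w => h (t * Y w `^ (-1)))).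
  by move=> w; rewrite inE /= => Aw; rewrite powR_inv1// ltW// (le_lt_trans A0).
apply: measurable_funS (_ : measurable_fun setT _) => //.
apply: (measurableT_comp mh); apply: measurable_funM => //.
exact: (measurableT_comp (measurable_powR (-1)) mY).
Qed.

Lemma integrable_scaled (h : R -> R) t A B : 0 <= A -> measurable_fun setT h ->
  (forall s, `|h s| <= B) -> P.-integrable (above A) (EFin \o (fun w => h (t / Y w))).
Proof.
move=> A0 mh hB; apply: (@integrable_bounded _ _ B) => //.
exact: measurable_scaled.
Qed.

Lemma moment_gt0 : Pr P (above 0) = 1 -> 0 < \int[P]_(w in above 0) (Y w `^ al).
Proof.
move=> P1; have m0 := measurable_above 0.
have ge0 : 0 <= \int[P]_(w in above 0) (Y w `^ al).
  by apply: Rintegral_ge0 => w _; exact: powR_ge0.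
rewrite lt_neqAle ge0 andbT; apply/eqP => int0.
have ii := integrable_powR_low (lexx 0).
have mf : measurable_fun (above 0) (EFin \o (fun w => Y w `^ al)).
  by case/integrableP: ii.
pose Y0 := above 0.
have : (\int[P]_(w in Y0) `|(Y w `^ al)%:E| = 0)%E.
  rewrite (eq_integral (fun w => (Y w `^ al)%:E)); last first.
    by move=> w _; rewrite gee0_abs// lee_fin powR_ge0.
  by rewrite -[LHS]fineK ?(integrable_fin_num _ ii)// -[X in X%:E]/(Rintegral _ _ _) -int0.
move=> /(ae_eq_integral_abs _ m0 mf).1 [N [mN N0 sub]].
have PN : (P Y0 <= P N)%E.
  apply: le_measure; rewrite ?inE// => w Yw; apply: sub => /=.
  by move=> /(_ Yw) [] /eqP; rewrite gt_eqF// powR_gt0.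
move: PN; rewrite N0 PrE// P1 lee_fin.
by rewrite ler10.
Qed.

Variables (F : R -> R) (Fmax : R).
Hypotheses (mF : measurable_fun setT F) (F_ge0 : forall s, 0 <= F s)
  (F_le : forall s, F s <= Fmax).

Let F_norm s : `|F s| <= Fmax. Proof. by rewrite ger0_norm. Qed.

Definition mean_scaled t := \int[P]_(w in above 0) F (t / Y w).
Definition moment := \int[P]_(w in above 0) (Y w `^ al).

(** Breiman's lemma in quantitative form: the estimate of [rv_uniform] is integrated over the law of
    Y, with an error that depends on Y only through its moments. *)
Lemma mean_scaled_approx e t : 0 <= e ->
  (forall m, 0 < m -> `|F (t / m) - m `^ al * F t| <= e * (1 + m `^ al + m `^ b) * F t) ->
  `|mean_scaled t - moment * F t| <= e * (1 + moment + C) * F t.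
Proof.
move=> e0 Fe; have m0 := measurable_above 0.
have i1 := integrable_scaled t (lexx 0) mF F_norm.
have i2 := integrable_powR_low (lexx 0).
have i3 := integrable_powR (lexx 0).
have ic : P.-integrable (above 0) (EFin \o (fun=> 1 : R)).
  exact: finite_measure_integrable_cst.
have i2F : P.-integrable (above 0) (EFin \o (fun w => Y w `^ al * F t)).
  exact: (integrableZr m0 (F t) i2).
have i12 : P.-integrable (above 0) (EFin \o (fun w => F (t / Y w) - Y w `^ al * F t)).
  exact: (integrableB m0 i1 i2F).
have ic2 : P.-integrable (above 0) (EFin \o (fun w => 1 + Y w `^ al)).
  exact: (integrableD m0 ic i2).
have ic23 : P.-integrable (above 0) (EFin \o (fun w => 1 + Y w `^ al + Y w `^ b)).
  exact: (integrableD m0 ic2 i3).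
have iR : P.-integrable (above 0)
    (EFin \o (fun w => (1 + Y w `^ al + Y w `^ b) * (e * F t))).
  exact: (integrableZr m0 (e * F t) ic23).
rewrite /mean_scaled /moment -RintegralZr// -RintegralB//.
apply: le_trans (le_normr_Rintegral m0 i12) _.
apply: (@le_trans _ _ (\int[P]_(w in above 0) ((1 + Y w `^ al + Y w `^ b) * (e * F t)))).
  apply: le_Rintegral => //; first exact: (integrable_abse i12).
  move=> w /= Yw; apply: le_trans (Fe _ Yw) _.
  by rewrite le_eqVlt; apply/orP; left; apply/eqP; ring.
rewrite RintegralZr// RintegralD// RintegralD// Rintegral_cst// mul1r.
rewrite -/moment mulrA (mulrC _ e) ler_wpM2r// ler_wpM2l//.
apply: lerD; last exact: Rintegral_powR_le.
by rewrite lerD2r -lee_fin fineK ?fin_num_measure// probability_le1.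
Qed.

(** The hypothesis is integrated at s = t / Y, where s^(-b) becomes t^(-b) Y^b, whose mean is
    controlled by C. *)
Lemma scaled_approx (h : R -> R) (B k c a t : R) : measurable_fun setT h ->
  (forall s, `|h s| <= B) -> 0 <= c -> 0 < t ->
  (forall s, 0 < s -> `|h s - k * F s| <= a * F s + c * s `^ (- b)) ->
  `|\int[P]_(w in above 0) h (t / Y w) - k * mean_scaled t| <=
  a * mean_scaled t + c * t `^ (- b) * C.
Proof.
move=> mh hB c0 t0 hF; have m0 := measurable_above 0.
have i1 := integrable_scaled t (lexx 0) mF F_norm.
have ih := integrable_scaled t (lexx 0) mh hB.
have i3 := integrable_powR (lexx 0).
have ik : P.-integrable (above 0) (EFin \o (fun w => k * F (t / Y w))).
  exact: (integrableZl m0 k i1).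
have ia : P.-integrable (above 0) (EFin \o (fun w => a * F (t / Y w))).
  exact: (integrableZl m0 a i1).
have ic : P.-integrable (above 0) (EFin \o (fun w => c * t `^ (- b) * Y w `^ b)).
  exact: (integrableZl m0 (c * t `^ (- b)) i3).
have ihk : P.-integrable (above 0) (EFin \o (fun w => h (t / Y w) - k * F (t / Y w))).
  exact: (integrableB m0 ih ik).
have iac : P.-integrable (above 0)
    (EFin \o (fun w => a * F (t / Y w) + c * t `^ (- b) * Y w `^ b)).
  exact: (integrableD m0 ia ic).
rewrite /mean_scaled -RintegralZl// -RintegralB//.
apply: le_trans (le_normr_Rintegral m0 ihk) _.
apply: (@le_trans _ _ (\int[P]_(w in above 0)
    (a * F (t / Y w) + c * t `^ (- b) * Y w `^ b))).
  apply: le_Rintegral => //; first exact: (integrable_abse ihk).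
  move=> w /= Yw; apply: le_trans (hF _ _) _; first by rewrite divr_gt0.
  rewrite lerD2l -mulrA ler_wpM2l// powRM ?invr_ge0 ?(ltW Yw) ?(ltW t0)//.
  by rewrite -[(Y w)^-1]powR_inv1 ?(ltW Yw)// -powRrM mulrN mulN1r opprK.
rewrite RintegralD// RintegralZl// RintegralZl// lerD2l ler_wpM2l//.
  by rewrite mulr_ge0// powR_ge0.
exact: Rintegral_powR_le.
Qed.

Lemma scaled_le (h : R -> R) (B c t : R) : measurable_fun setT h ->
  (forall s, `|h s| <= B) -> (forall s, h s <= c * F s) ->
  \int[P]_(w in above 0) h (t / Y w) <= c * mean_scaled t.
Proof.
move=> mh hB hF; have m0 := measurable_above 0.
have i1 := integrable_scaled t (lexx 0) mF F_norm.
have ih := integrable_scaled t (lexx 0) mh hB.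
rewrite /mean_scaled -RintegralZl//; apply: le_Rintegral => //.
exact: (integrableZl m0 c i1).
Qed.

Lemma scaled_tail_le (h : R -> R) (B c e t A : R) : 0 <= A -> 0 <= c -> 0 <= e ->
  measurable_fun setT h -> (forall s, `|h s| <= B) -> (forall s, h s <= c * F s) ->
  (forall m, A <= m -> F (t / m) <= e * m `^ b * F t) ->
  \int[P]_(w in above A) h (t / Y w) <= c * e * C * F t.
Proof.
move=> A0 c0 e0 mh hB hF Fe; have mA := measurable_above A.
have ih := integrable_scaled t A0 mh hB.
have i3 := integrable_powR A0.
have ie : P.-integrable (above A) (EFin \o (fun w => c * e * F t * Y w `^ b)).
  exact: (integrableZl mA (c * e * F t) i3).
apply: (@le_trans _ _ (\int[P]_(w in above A) (c * e * F t * Y w `^ b))).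
  apply: le_Rintegral => // w /= Aw; apply: le_trans (hF _) _.
  have := Fe _ (ltW Aw) => /(ler_wpM2l c0) h1; apply: le_trans h1 _.
  by rewrite le_eqVlt; apply/orP; left; apply/eqP; ring.
rewrite RintegralZl// [leRHS]mulrAC ler_wpM2l ?mulr_ge0//.
exact: Rintegral_powR_le.
Qed.

End Moments.

(** * From t^(-al) L(t) to a monotone equivalent *)

Section Equivalence.
Context {R : realType}.
Variables (F L : R -> R) (al : R).
Hypothesis F_ge0 : forall t, 0 <= F t.
Hypothesis F_noninc : forall s t, s <= t -> F t <= F s.
Hypothesis L_sv : slowly_varying L.
Local Notation ell := (fun t => t `^ (- al) * L t).
Hypothesis F_ell : F t / ell t @[t --> +oo] --> (1 : R).

(** The sign of L for large t is deduced from F >= 0 and a ratio close to 1. *)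
Lemma F_ell_near (e : R) : 0 < e -> e <= 1 ->
  \forall t \near +oo, [/\ 0 < F t, 0 < ell t & `|F t - ell t| <= e * F t].
Proof.
move=> e0 e1; have e2 : 0 < e / 2 by rewrite divr_gt0.
have /cvgrPdist_le /(_ _ e2) := F_ell; apply: filterS => t /= h.
have [ell0|ell0|ell0] := ltgtP (ell t) 0; last first.
(* The inverse of 0 is 0, so the ratio would be 0, which is not close to 1. *)
- by move: h; rewrite ell0 invr0 mulr0 subr0 normr1; lra.
- have : `|(1 - F t / ell t) * ell t| <= e / 2 * ell t.
    by rewrite normrM (gtr0_norm ell0) ler_pM2r.
  rewrite mulrBl mul1r divfK ?gt_eqF// ler_norml => /andP[h1 h2].
  have h3 : e * (ell t) <= ell t by rewrite ler_piMl// ltW.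
  have h4 : e * (e * ell t) <= e * ell t by rewrite ler_pM2l.
  have F0 : 0 < F t by lra.
  have h5 : e * (ell t - e / 2 * ell t) <= e * F t by rewrite ler_pM2l//; lra.
  by split => //; rewrite ler_norml; apply/andP; split; lra.
- have : F t / ell t <= 0 by rewrite mulr_ge0_le0// invr_le0 ltW.
  by move: h; rewrite ler_norml => /andP[h1 h2]; lra.
Qed.

Lemma equiv_F_gt0 t : 0 < F t.
Proof.
near (@pinfty_nbhs R) => s.
have [Fs _ _] : [/\ 0 < F s, 0 < ell s & `|F s - ell s| <= 1 * F s].
  by near: s; exact: F_ell_near.
by apply: lt_le_trans Fs _; apply: F_noninc; near: s; apply: nbhs_pinfty_ge; exact: num_real.
Unshelve. all: by end_near. Qed.

Lemma equiv_F_rv (l : R) : 0 < l -> F (l * t) / F t @[t --> +oo] --> l `^ (- al).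
Proof.
move=> l0.
have lty : l * t @[t --> +oo] --> +oo by apply: gt0_cvgMry => //; exact: cvg_id.
have c1 : F (l * t) / ell (l * t) @[t --> +oo] --> (1 : R).
  exact: (cvg_comp _ (fun s => F s / ell s) lty F_ell).
have c2 : L (l * t) / L t @[t --> +oo] --> (1 : R) by exact: L_sv.
have c3 : (F t / ell t)^-1 @[t --> +oo] --> (1^-1 : R).
  by apply: cvgV F_ell; exact: oner_neq0.
have c4 := cvgM (cvgM c1 (cvgM (cvg_cst (l `^ (- al))) c2)) c3.
rewrite mul1r mulr1 invr1 mulr1 in c4.
have nl := lty _ (F_ell_near ltr01 (lexx 1)).
pose f t := F (l * t) / ell (l * t) * (l `^ (- al) * (L (l * t) / L t)) * (F t / ell t)^-1.
have {}c4 : f t @[t --> +oo] --> l `^ (- al) by exact: c4.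
apply: cvg_trans c4; apply: (@near_eq_cvg _ _ _ _ f (fun t => F (l * t) / F t)).
near=> t; rewrite /f.
have t0 : 0 < t by near: t; apply: nbhs_pinfty_gt; exact: num_real.
have [Ft lt _] : [/\ 0 < F t, 0 < ell t & `|F t - ell t| <= 1 * F t].
  by near: t; exact: F_ell_near.
have [Flt llt _] : [/\ 0 < F (l * t), 0 < ell (l * t) &
    `|F (l * t) - ell (l * t)| <= 1 * F (l * t)] by near: t; exact: nl.
have Lt : L t != 0 by apply: contraL lt => /eqP ->; rewrite mulr0 ltxx.
have Llt : L (l * t) != 0 by apply: contraL llt => /eqP ->; rewrite mulr0 ltxx.
rewrite powRM ?(ltW l0) ?(ltW t0)//; field.
by rewrite Lt Llt !gt_eqF ?powR_gt0.
Unshelve. all: by end_near. Qed.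

End Equivalence.

(** * Comparison of the tail at nearby scales *)

Section RegularlyVaryingTail.
Context {R : realType}.
Variables (F : R -> R) (al : R).
Hypothesis F_gt0 : forall t, 0 < F t.
Hypothesis F_noninc : forall s t, s <= t -> F t <= F s.
Hypothesis al_gt0 : 0 < al.
Hypothesis F_rv : forall l : R, 0 < l -> F (l * t) / F t @[t --> +oo] --> l `^ (- al).

Lemma near_scale (P : R -> Prop) (l : R) : 0 < l ->
  (\forall t \near +oo, P t) -> \forall t \near +oo, P (l * t).
Proof.
move=> l0 nP; have lty : l * t @[t --> +oo] --> +oo.
  by apply: gt0_cvgMry => //; exact: cvg_id.
exact: lty.
Qed.

Lemma near_F_scale_le (l : R) : 0 < l ->
  exists2 C, 0 < C & \forall t \near +oo, F (l * t) <= C * F t.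
Proof.
move=> l0; have li0 : 0 < l^-1 by rewrite invr_gt0.
exists (l^-1 `^ al + 1); first by rewrite addr_gt0 ?powR_gt0.
have := @rv_near _ _ _ F_gt0 F_rv _ _ li0 ltr01; apply: filterS => t.
by rewrite invrK mulrC mul1r ler_norml => /andP[_ h]; rewrite mulrDl mul1r; lra.
Qed.

Lemma near_F_perturb (eta : R) : 0 < eta -> eta < 1 -> exists2 e, 0 < e < 1 &
  \forall t \near +oo, F ((1 - e) * t) <= (1 + eta) * F t /\
    (1 - eta) * F t <= F ((1 + e) * t).
Proof.
move=> eta0 eta1.
have sum1 : eta / 2 + (1 + eta / 2) <= 1 + eta by lra.
have sum2 : 1 - eta <= - (eta / 2) + (1 - eta / 2) by lra.
have pw (x : R) : 0 <= x -> (x `^ al^-1) `^ al = x.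
  by move=> x0; rewrite -powRrM mulVf ?gt_eqF// powRr1.
have al'0 : 0 < al^-1 by rewrite invr_gt0.
(* Half of eta is spent on these exact factors and half on the error of [rv_near]; [e] is then
   chosen with 1 - e >= 1 / l and 1 + e <= 1 / l', and monotonicity concludes. *)
pose l := (1 + eta / 2) `^ al^-1; pose l' := (1 - eta / 2) `^ al^-1.
have l1 : 1 < l.
  have := @powR_ltr_exp _ (1 + eta / 2) 0 al^-1 ltac:(lra) al'0.
  by rewrite powRr0.
have l'1 : l' < 1.
  have <- : (1 : R) `^ al^-1 = 1 by rewrite powR1.
  by apply: gt0_ltr_powR; rewrite ?nnegrE; lra.
have l'0 : 0 < l' by rewrite powR_gt0; lra.
have l0 : 0 < l by rewrite (lt_trans _ l1).
have li1 : l^-1 < 1 by rewrite invf_lt1.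
have l'i1 : 1 < l'^-1 by rewrite invf_gt1.
have lV : 0 < l^-1 by rewrite invr_gt0.
have lal : l `^ al = 1 + eta / 2 by rewrite /l pw//; lra.
have l'al : l' `^ al = 1 - eta / 2 by rewrite /l' pw//; lra.
clearbody l l'.
pose e := Num.min (1 - l^-1) (l'^-1 - 1).
exists e.
  by rewrite /e lt_min gt_min; apply/andP; split; [apply/andP; split|apply/orP; left]; lra.
have e1 : e <= 1 - l^-1 by rewrite /e ge_min lexx.
have e2 : e <= l'^-1 - 1 by rewrite /e ge_min lexx orbT.
have eta2 : 0 < eta / 2 by lra.
have n1 := @rv_near _ _ _ F_gt0 F_rv _ _ l0 eta2.
have n2 := @rv_near _ _ _ F_gt0 F_rv _ _ l'0 eta2.
near=> t; have t0 : 0 < t by near: t; apply: nbhs_pinfty_gt; exact: num_real.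
split.
  apply: (@le_trans _ _ (F (t / l))).
    by apply: F_noninc; rewrite mulrC ler_pM2r// lerBrDl -lerBrDr.
  have : `|F (t / l) - l `^ al * F t| <= eta / 2 * F t by near: t; exact: n1.
  rewrite lal ler_norml => /andP[_]; rewrite lerBlDr -mulrDl => h.
  by apply: le_trans h _; rewrite ler_pM2r.
apply: (@le_trans _ _ (F (t / l'))).
  have : `|F (t / l') - l' `^ al * F t| <= eta / 2 * F t by near: t; exact: n2.
  rewrite l'al ler_norml => /andP[+ _]; rewrite lerBrDr -mulNr -mulrDl => h.
  by apply: le_trans h; rewrite ler_pM2r.
by apply: F_noninc; rewrite [leLHS]mulrC ler_pM2l// -lerBrDl.
Unshelve. all: by end_near. Qed.

End RegularlyVaryingTail.

(** * Asymptotics of the conditional tails by contraction *)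

Section Asymptotics.
Context d (T : measurableType d) (R : realType) (P : probability T R) (D : countType).
Variables (X : int -> T -> D) (Q M : int -> D -> T -> R).
Hypothesis chain : stationary_irreducible_markov_chain P X.
Hypothesis mQM : pairs_measurable Q M.
Hypothesis indep : pairs_independent_of_chain P X Q M.
Hypothesis ident : pairs_identically_distributed P Q M.
Hypothesis M_gt0 : forall i, Pr P [set w | 0 < M 0 i w] = 1.

Variables (al b c C : R).
Hypotheses (al_gt0 : 0 < al) (al_b : al < b).
Hypothesis M_moment : forall i, (\int[P]_w (`|M 0 i w| `^ b)%:E <= C%:E)%E.
Local Notation mom i := (moment P (M 0 i) al).
Hypotheses (c_ge0 : 0 <= c) (c_lt1 : c < 1) (mom_le : forall i, mom i <= c).

Variables (F : R -> R) (Fmax : R).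
Hypothesis F_gt0 : forall t, 0 < F t.
Hypothesis F_noninc : forall s t, s <= t -> F t <= F s.
Hypothesis F_le : forall t, F t <= Fmax.
Hypothesis F_rv : forall l : R, 0 < l -> F (l * t) / F t @[t --> +oo] --> l `^ (- al).
Hypothesis F_cvg0 : F t @[t --> +oo] --> (0 : R).

Variables (q : D -> R) (Cq : R).
Hypothesis Q_tail : forall e, 0 < e -> \forall t \near +oo, forall i,
  `|Pr P [set w | t < Q 0 i w] - q i * F t| <= e * F t.
Hypothesis Cq_ge0 : 0 <= Cq.
Hypothesis Q_abs_tail : \forall t \near +oo, forall i,
  Pr P [set w | t < `|Q 0 i w|] <= Cq * F t.

Local Notation now := (now P X Q M).
Local Notation before := (before P X Q M).
Local Notation limit_tail := (tail (@perpetuity_lim R D)).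
Local Notation mean i := (mean_scaled P (M 0 i) F).

Let mM i : measurable_fun setT (M 0 i). Proof. by case: (mQM 0 i). Qed.
Let mF : measurable_fun setT F. Proof. exact: nonincreasing_measurable. Qed.
Let F_ge0 t : 0 <= F t. Proof. exact: ltW. Qed.

Lemma mom_ge0 i : 0 <= mom i.
Proof. by apply: Rintegral_ge0 => w _; exact: powR_ge0. Qed.

(** Uniform in i because M_{0,i} enters the error only through the common bounds C and c. *)
Lemma mean_near (e : R) : 0 < e ->
  \forall t \near +oo, forall i, `|mean i t - mom i * F t| <= e * F t.
Proof.
move=> e0; pose e' := e / (2 + `|C|).
have C2 : 0 < 2 + `|C| by rewrite ltr_pwDl.
have e'0 : 0 < e' by rewrite divr_gt0.
have := @rv_uniform _ _ _ F_gt0 F_noninc al_gt0 F_rv b Fmax e' al_b F_le e'0.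
apply: filterS => t Ft i.
have := mean_scaled_approx (mM i) al_gt0 al_b (M_moment i) mF F_ge0 F_le (ltW e'0) Ft.
move=> h; apply: le_trans h _; rewrite ler_pM2r//.
have -> : e = e' * (2 + `|C|) by rewrite divfK// gt_eqF.
rewrite ler_pM2l//; apply: lerD (ler_norm C).
by rewrite (_ : 2 = 1 + 1 :> R)// lerD2l (le_trans (mom_le i))// ltW.
Qed.

Lemma before_tail_le i W s x : measurable_fun setT W -> 0 <= x ->
  (forall j, now j (tail W s) <= x) -> before i (tail W s) <= x.
Proof.
move=> mW x0 h; have mt := measurable_tail s mW.
apply: (esum_weight_le (Hrev_ge0 P X i) (before_esum chain mQM indep ident i mt)
  (esym (esum_weight_cst (Hrev_ge0 P X i) (esum_Hrev chain mQM indep ident i) x0))) => j.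
exact: h.
Qed.

Lemma norm_before_le1 i W s : measurable_fun setT W -> `|before i (tail W s)| <= 1.
Proof.
move=> mW; rewrite ger0_norm ?before_ge0//.
by apply: before_le1 => //; exact: measurable_tail.
Qed.

(** Induction on N with a constant that reproduces itself: a bound C0 F for N terms becomes (Cq C1 +
    C0 rho) F for N + 1 terms, and rho < 1. *)
Lemma now_abs_perpetuity_bound : exists2 C0, 0 < C0 &
  forall N i t, now i (tail (abs_perpetuity N) t) <= C0 * F t.
Proof.
have [c0 c1] := (c_ge0, c_lt1); pose eta := (1 - c) / 8.
have [eta0 eta1] : 0 < eta /\ eta < 1 by rewrite /eta; split; lra.
have [e /andP[e0 e1] pert] := near_F_perturb F_gt0 F_noninc al_gt0 F_rv eta0 eta1.
have [C1 C10 C1P] := near_F_scale_le F_gt0 F_rv e0.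
have e1' : 0 < 1 - e by rewrite subr_gt0.
have [t0 [_ t0P]] : \forall t \near +oo, [/\ F ((1 - e) * t) <= (1 + eta) * F t,
    forall i, mean i ((1 - e) * t) <= (c + eta) * F ((1 - e) * t) &
    forall i, Pr P [set w | e * t < `|Q 0 i w|] <= Cq * C1 * F t].
  have n1 := near_scale e1' (mean_near eta0).
  have n2 := near_scale e0 Q_abs_tail.
  near=> t; split.
  - by have [] : F ((1 - e) * t) <= (1 + eta) * F t /\
      (1 - eta) * F t <= F ((1 + e) * t) by near: t.
  - move=> i; have : forall i, `|mean i ((1 - e) * t) - mom i * F ((1 - e) * t)| <=
      eta * F ((1 - e) * t) by near: t; exact: n1.
    move=> /(_ i); rewrite ler_norml => /andP[_ h].
    have : mom i * F ((1 - e) * t) <= c * F ((1 - e) * t) by rewrite ler_pM2r.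
    lra.
  - move=> i; have : forall i, Pr P [set w | e * t < `|Q 0 i w|] <= Cq * F (e * t).
      by near: t; exact: n2.
    move=> /(_ i) h; apply: le_trans h _; rewrite -mulrA ler_wpM2l//.
    by near: t; exact: C1P.
(* Beyond t1 >= 0 the tail event of the empty sum is empty, which starts the induction. *)
pose t1 := Num.max t0 0.
(* The first factor comes from averaging over M, the second from returning from (1 - e) t to t. *)
pose rho := (c + eta) * (1 + eta).
have rho1 : rho < 1.
  have : eta * (c + eta) <= eta * 1 by rewrite ler_pM2l// /eta; lra.
  rewrite /rho mulrDr mulr1 [_ * eta]mulrC /eta; lra.
(* The first entry makes the bound at least 1 for t <= t1; the second is the fixed point of x -> Cq
   C1 + rho x. *)
pose C0 := Num.max (F t1)^-1 (Cq * C1 / (1 - rho)).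
have C00 : 0 < C0 by rewrite lt_max invr_gt0 F_gt0.
have C0F t : t <= t1 -> 1 <= C0 * F t.
  move=> tt1; apply: (@le_trans _ _ (C0 * F t1)); last by rewrite ler_pM2l// F_noninc.
  by rewrite -ler_pdivrMr// mul1r /C0 le_max lexx.
have C0rho : Cq * C1 + C0 * rho <= C0.
  have : Cq * C1 / (1 - rho) <= C0 by rewrite /C0 le_max lexx orbT.
  by rewrite ler_pdivrMr ?subr_gt0//; lra.
exists C0 => //; elim=> [|N IH] i t.
  have [tt1|t1t] := leP t t1.
    apply: le_trans (C0F _ tt1); apply: now_le1 => //.
    by apply: measurable_tail; exact: measurable_abs_perpetuity.
  rewrite (_ : tail _ _ = set0); last first.
    apply/seteqP; split => // p; rewrite /tail /= /abs_perpetuity /= lte_fin => p0.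
    by move: t1t; rewrite /t1 gt_max => /andP[_]; rewrite ltNge (ltW p0).
  rewrite /now /= preimage_set0 /cP /cprob set0I Pr_set0 mul0r.
  by rewrite mulr_ge0// ltW.
have [tt1|t1t] := leP t t1.
  apply: le_trans (C0F _ tt1); apply: now_le1 => //.
  by apply: measurable_tail; exact: measurable_abs_perpetuity.
have t0t : t0 < t by apply: le_lt_trans t1t; rewrite /t1 le_max lexx.
have [h1 h2 h3] := t0P t t0t.
apply: le_trans (now_abs_perpetuity_le chain mQM indep ident M_gt0 N i e t) _.
have mN := @measurable_abs_perpetuity R D N.
have h4 := scaled_le P (mM i) mF F_ge0 F_le ((1 - e) * t)
  (measurable_before_tail chain mQM i mN) (fun s => norm_before_le1 i s mN)
  (fun s => before_tail_le i mN (mulr_ge0 (ltW C00) (F_ge0 s)) (fun j => IH j s)).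
have h5 : C0 * mean i ((1 - e) * t) <= C0 * (rho * F t).
  rewrite ler_pM2l//; apply: le_trans (h2 i) _; rewrite /rho -mulrA ler_wpM2l//.
  by rewrite addr_ge0// ltW.
have h6 : (Cq * C1 + C0 * rho) * F t <= C0 * F t by rewrite ler_pM2r.
have := h3 i; rewrite /M_above; lra.
Unshelve. all: by end_near. Qed.

Lemma before_abs_lim_bound : exists2 C0, 0 < C0 &
  forall i t, before i (tail (@abs_lim R D) t) <= C0 * F t.
Proof.
have [C0 C00 h] := now_abs_perpetuity_bound.
exists C0 => // i t; apply: before_tail_le.
- exact: measurable_abs_lim.
- by rewrite mulr_ge0// ltW.
- by move=> j; apply: now_abs_lim_le => // N; exact: h.
Qed.

(** In [joint_tail_le], the part M > A is made small by the Potter bound with A large. With A fixed,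
    the product is at most a constant times F(t) F(dl t / A), and the last factor tends to 0. *)
Lemma joint_tail_small (dl e : R) : 0 < dl -> 0 < e ->
  \forall t \near +oo, forall i, joint_tail P X Q M i dl t <= e * F t.
Proof.
move=> dl0 e0; have [C0 C00 C0P] := before_abs_lim_bound.
have [C1 C10 C1P] := near_F_scale_le F_gt0 F_rv dl0.
pose e2 := e / 2 / (Cq * C1 * C0 + 1).
have den2 : 0 < Cq * C1 * C0 + 1 by rewrite ltr_wpDl// !mulr_ge0// ltW.
have e20 : 0 < e2 by rewrite !divr_gt0.
pose e1 := e / 2 / (C0 * C1 * `|C| + 1).
have den1 : 0 < C0 * C1 * `|C| + 1 by rewrite ltr_wpDl// !mulr_ge0// ltW.
have e10 : 0 < e1 by rewrite !divr_gt0.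
have [A A1 AP] := @potter_tail _ _ _ F_gt0 F_noninc al_gt0 F_rv b Fmax e1 al_b F_le e10.
have A0 : 0 < A by rewrite (lt_le_trans _ A1).
have dlA : 0 < dl / A by rewrite divr_gt0.
have small : \forall t \near +oo, F t <= e2.
  have /cvgrPdist_le /(_ _ e20) := F_cvg0.
  by apply: filterS => t; rewrite sub0r normrN; apply: le_trans; exact: ler_norm.
have {}small := near_scale dlA small.
have n1 := near_scale dl0 Q_abs_tail; have n2 := near_scale dl0 AP.
have mW := @measurable_abs_lim R D.
near=> t => i; have t0 : 0 < t by near: t; apply: nbhs_pinfty_gt; exact: num_real.
apply: le_trans (joint_tail_le chain mQM indep ident M_gt0 i A0 dl0 t0) _.
have Fdl : F (dl * t) <= C1 * F t by near: t; exact: C1P.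
have h1 : forall i, Pr P [set w | dl * t < `|Q 0 i w|] <= Cq * F (dl * t) by near: t; exact: n1.
have h2 : forall m, A <= m -> F (dl * t / m) <= e1 * m `^ b * F (dl * t) by near: t; exact: n2.
have h3 : F (dl / A * t) <= e2 by near: t; exact: small.
have tail2 := scaled_tail_le (mM i) (M_moment i) F_ge0 (ltW A0) (ltW C00) (ltW e10)
  (measurable_before_tail chain mQM i mW) (fun s => norm_before_le1 i s mW)
  (C0P i) h2.
have -> : e * F t = e / 2 * F t + e / 2 * F t by field.
apply: lerD.
  apply: (@le_trans _ _ (Cq * (C1 * F t) * (C0 * e2))).
    apply: ler_pM; rewrite ?Pr_ge0 ?before_ge0//.
      by apply: le_trans (h1 i) _; rewrite ler_wpM2l.
    apply: le_trans (C0P _ _) _; rewrite ler_pM2l//.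
    by rewrite [_ / A](_ : _ = dl / A * t)// mulrAC.
  have -> : Cq * (C1 * F t) * (C0 * e2) = Cq * C1 * C0 * e2 * F t by ring.
  rewrite ler_pM2r//; have -> : e / 2 = (Cq * C1 * C0 + 1) * e2.
    by rewrite /e2 [RHS]mulrC divfK// gt_eqF.
  by rewrite ler_pM2r// lerDl.
apply: le_trans tail2 _.
apply: (@le_trans _ _ (C0 * e1 * `|C| * (C1 * F t))).
  apply: ler_pM => //.
  - have CC : 0 <= C by exact: (moment_ge0 (mM i) (M_moment i)).
    by apply: mulr_ge0 => //; apply: mulr_ge0; exact: ltW.
  - by apply: ler_wpM2l (ler_norm C); apply: mulr_ge0; exact: ltW.
have -> : C0 * e1 * `|C| * (C1 * F t) = C0 * C1 * `|C| * e1 * F t by ring.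
rewrite ler_pM2r//; have -> : e / 2 = (C0 * C1 * `|C| + 1) * e1.
  by rewrite /e1 [RHS]mulrC divfK// gt_eqF.
by rewrite ler_pM2r// lerDl.
Unshelve. all: by end_near. Qed.

Variables (K : D -> R) (k : R).
Hypotheses (k_ge0 : 0 <= k) (K_le : forall j, `|K j| <= k).
Hypothesis K_eq : forall i, K i = q i + mom i * average (Hrev P X i) K k.

Local Notation within B := (\forall t \near +oo, forall i,
  `|now i (limit_tail t) - K i * F t| <= B * F t).

(** [within B] concerns large arguments only, while s = t / M takes all positive values. Below the
    threshold s0 the trivial bound 1 + k Fmax is dominated by C2 s^(-b), which after integration
    over M is only O(t^(-b)) = o(F(t)). *)
Lemma before_approx (B : R) : 0 <= B -> within B ->
  exists2 C2, 0 <= C2 & forall i s, 0 < s ->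
    `|before i (limit_tail s) - average (Hrev P X i) K k * F s| <=
    B * F s + C2 * s `^ (- b).
Proof.
move=> B0 [s1 [_ s1P]]; pose s0 := Num.max s1 1.
have s00 : 0 < s0 by rewrite lt_max ltr01 orbT.
have mW := @measurable_perpetuity_lim R D.
have Fmax0 : 0 <= Fmax by apply: le_trans (F_le 0).
exists ((1 + k * Fmax) * s0 `^ b).
  by rewrite mulr_ge0 ?powR_ge0// addr_ge0// mulr_ge0.
move=> i s sp; have mt := measurable_tail s mW.
apply: (average_approx (Hrev_ge0 P X i) (esum_Hrev chain mQM indep ident i) k_ge0 K_le
  (F_ge0 s) (fun j => now_ge0 P X Q M j _) (before_esum chain mQM indep ident i mt)) => j.
have c0 : 0 <= (1 + k * Fmax) * s0 `^ b * s `^ (- b).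
  by rewrite !mulr_ge0 ?powR_ge0// addr_ge0// mulr_ge0.
have [ss0|s0s] := leP s s0; last first.
  have := s1P s; rewrite /= (le_lt_trans _ s0s) ?le_max ?lexx// => /(_ isT j) h.
  by apply: le_trans h _; rewrite lerDl.
apply: (@le_trans _ _ (1 + k * Fmax)).
  apply: le_trans (ler_normB _ _) _; apply: lerD.
    rewrite ger0_norm ?now_ge0//; exact: now_le1.
  by rewrite normrM (ger0_norm (F_ge0 s)); apply: ler_pM.
apply: (@le_trans _ _ ((1 + k * Fmax) * s0 `^ b * s `^ (- b))); last first.
  by rewrite lerDr mulr_ge0.
rewrite -mulrA ler_peMr ?addr_ge0 ?mulr_ge0// powRN.
rewrite ler_pdivlMr ?powR_gt0// mul1r ge0_ler_powR ?nnegrE ?(ltW sp) ?(ltW s00)//.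
by rewrite ltW// (lt_trans al_gt0).
Qed.

(** The main terms cancel by [K_eq], and the error B comes out multiplied by the mean of M^al, at
    most c; all the rest is proportional to dl. *)
Lemma one_step_approx (B dl : R) : 0 <= B -> 0 < dl -> within B ->
  \forall t \near +oo, forall i,
    `|Pr P [set w | t < Q 0 i w] +
      \int[P]_(w in M_above M i 0) before i (limit_tail (t / M 0 i w)) - K i * F t| <=
    (c * B + dl * (B + k + 3)) * F t.
Proof.
move=> B0 dl0 wB; have [C2 C20 C2P] := before_approx B0 wB.
pose e2 := dl / (C2 * `|C| + 1).
have den : 0 < C2 * `|C| + 1 by rewrite ltr_wpDl// mulr_ge0.
have e20 : 0 < e2 by rewrite divr_gt0.
have mW := @measurable_perpetuity_lim R D.
have n1 := Q_tail dl0; have n2 := mean_near dl0.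
have n3 := @near_powRN_le_tail _ _ _ F_gt0 F_noninc al_gt0 F_rv b Fmax e2 al_b F_le e20.
near=> t => i; have t0 : 0 < t by near: t; apply: nbhs_pinfty_gt; exact: num_real.
have h1 : forall i, `|Pr P [set w | t < Q 0 i w] - q i * F t| <= dl * F t by near: t; exact: n1.
have h2 : forall i, `|mean i t - mom i * F t| <= dl * F t by near: t; exact: n2.
have h3 : t `^ (- b) <= e2 * F t by near: t; exact: n3.
have h4 := scaled_approx (mM i) (M_moment i) mF F_ge0 F_le
  (measurable_before_tail chain mQM i mW) (fun s => norm_before_le1 i s mW) C20 t0 (C2P i).
set hk := average _ _ _ in h4; rewrite K_eq -/hk.
set I := \int[P]_(w in _) _ in h4 *; set p := Pr P _.
have hk_le : `|hk| <= k.
  exact: (norm_average_le (Hrev_ge0 P X i) (esum_Hrev chain mQM indep ident i) k_ge0 K_le).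
have h5 : C2 * t `^ (- b) * C <= dl * F t.
  apply: (@le_trans _ _ (C2 * t `^ (- b) * `|C|)).
    by rewrite ler_wpM2l ?ler_norm// mulr_ge0// powR_ge0.
  rewrite mulrAC; apply: (@le_trans _ _ (C2 * `|C| * (e2 * F t))).
    by rewrite ler_wpM2l// mulr_ge0.
  rewrite mulrA ler_pM2r//; have -> : dl = (C2 * `|C| + 1) * e2.
    by rewrite /e2 [RHS]mulrC divfK// gt_eqF.
  by rewrite ler_pM2r// lerDl.
have h6 : B * mean i t <= B * ((c + dl) * F t).
  rewrite ler_wpM2l//; have := h2 i; rewrite ler_norml => /andP[_].
  rewrite lerBlDr => h; apply: le_trans h _; rewrite addrC mulrDl lerD2r.
  by rewrite ler_pM2r.
have h7 : `|hk * mean i t - hk * mom i * F t| <= k * (dl * F t).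
  by rewrite -mulrA -mulrBr normrM ler_pM.
have -> : p + I - (q i + mom i * hk) * F t =
    (p - q i * F t) + (I - hk * mean i t) + (hk * mean i t - hk * mom i * F t) by ring.
apply: le_trans (ler_normD _ _) _; apply: le_trans (lerD (ler_normD _ _) (lexx _)) _.
have := h1 i; rewrite -/p => h8.
have -> : (c * B + dl * (B + k + 3)) * F t =
    (dl * F t + (B * ((c + dl) * F t) + dl * F t)) + k * (dl * F t) + dl * F t by ring.
rewrite -[leLHS]addr0; apply: lerD; last by rewrite mulr_ge0// ltW.
by apply: lerD => //; apply: lerD => //; apply: le_trans h4 _; apply: lerD.
Unshelve. all: by end_near. Qed.

(** The tail at t is enclosed between the one-step expressions at (1 - ep) t and (1 + ep) t, up to
    joint tails; [one_step_approx] evaluates them and [near_F_perturb] brings F back to t. *)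
Lemma within_contraction (B e : R) : 0 <= B -> 0 < e -> within B -> within (c * B + e).
Proof.
(* [den] is the total coefficient of dl in [total], once a is bounded by 2 B + k + 3 in the product
   a dl. *)
move=> B0 e0 wB; pose den := 3 * B + 3 * k + 8.
have den0 : 0 < den by have := k_ge0; rewrite /den; lra.
have [dl [dl0 dl1 dle]] : exists dl, [/\ 0 < dl, dl < 1 & dl * den <= e].
  exists (Num.min (1 / 2) (e / den)); split.
  - by rewrite lt_min !divr_gt0.
  - by rewrite gt_min; apply/orP; left; lra.
  - by rewrite -ler_pdivlMr// ge_min lexx orbT.
pose a := c * B + dl * (B + k + 3).
have Bk0 : 0 <= B + k + 3 by have := k_ge0; lra.
have a0 : 0 <= a by rewrite addr_ge0 ?mulr_ge0// ltW.
have a_le : a <= 2 * B + k + 3.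
  have h1 : c * B <= B by rewrite ler_piMl// ltW.
  have h2 : dl * (B + k + 3) <= B + k + 3 by rewrite ler_piMl// ltW.
  by rewrite /a; lra.
have total : k * dl + a * (1 + dl) + 2 * dl <= c * B + e.
  have h1 : a * dl <= (2 * B + k + 3) * dl by rewrite ler_pM2r.
  by move: dle h1; rewrite /den /a; lra.
have [ep ep01 pert] := near_F_perturb F_gt0 F_noninc al_gt0 F_rv dl0 dl1.
have /andP[ep0 ep1] := ep01.
have ep1' : 0 < 1 - ep by rewrite subr_gt0.
have ep2' : 0 < 1 + ep by rewrite addr_gt0.
have ep2 : 0 < ep / 2 by rewrite divr_gt0.
have st := one_step_approx B0 dl0 wB; rewrite -/a in st.
have n1 := near_scale ep1' st; have n2 := near_scale ep2' st.
have n3 := joint_tail_small ep2 dl0.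
clearbody a; clear st dle den0 den.
near=> t => i; have t0 : 0 < t by near: t; apply: nbhs_pinfty_gt; exact: num_real.
have [F1 F2] : F ((1 - ep) * t) <= (1 + dl) * F t /\ (1 - dl) * F t <= F ((1 + ep) * t).
  by near: t; exact: pert.
have F1' : F t <= F ((1 - ep) * t).
  by apply: F_noninc; rewrite ler_piMl ?(ltW t0)// lerBlDr lerDl ltW.
have F2' : F ((1 + ep) * t) <= F t.
  by apply: F_noninc; rewrite ler_peMl ?(ltW t0)// lerDl ltW.
have J : joint_tail P X Q M i (ep / 2) t <= dl * F t.
  by move: i; near: t; exact: n3.
have U := now_lim_le chain mQM indep ident M_gt0 i ep01 t0.
have L := now_lim_ge chain mQM indep ident M_gt0 i ep01 t0.
have S1 : `|Pr P [set w | (1 - ep) * t < Q 0 i w] +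
    \int[P]_(w in M_above M i 0) before i (limit_tail ((1 - ep) * t / M 0 i w)) -
    K i * F ((1 - ep) * t)| <= a * F ((1 - ep) * t).
  by move: i {J U L}; near: t; exact: n1.
have S2 : `|Pr P [set w | (1 + ep) * t < Q 0 i w] +
    \int[P]_(w in M_above M i 0) before i (limit_tail ((1 + ep) * t / M 0 i w)) -
    K i * F ((1 + ep) * t)| <= a * F ((1 + ep) * t).
  by move: i {J U L S1}; near: t; exact: n2.
set f := now i _ in U L *; set jt := joint_tail _ _ _ _ _ _ _ in J U L.
(* The one-step expressions are replaced by abstract scalars, leaving a purely linear problem. *)
have [S [S1' U']] : exists S, `|S - K i * F ((1 - ep) * t)| <= a * F ((1 - ep) * t) /\
    f <= S + jt by eexists; split; [exact: S1|exact: U].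
have [S' [S2' L']] : exists S, `|S - K i * F ((1 + ep) * t)| <= a * F ((1 + ep) * t) /\
    S <= f + 2 * jt by eexists; split; [exact: S2|exact: L].
clear S1 S2 U L; move: U' L' S1' S2'.
rewrite !ler_norml => U L /andP[_ S1] /andP[S2 _].
have KF1 : K i * (F ((1 - ep) * t) - F t) <= k * (dl * F t).
  apply: le_trans (ler_norm _) _; rewrite normrM; apply: ler_pM => //.
  by rewrite ger0_norm ?subr_ge0// lerBlDr; apply: le_trans F1 _; rewrite mulrDl mul1r addrC.
have KF2 : - (k * (dl * F t)) <= K i * (F ((1 + ep) * t) - F t).
  rewrite lerNl; apply: le_trans (ler_norm _) _; rewrite normrN normrM; apply: ler_pM => //.
  rewrite ler0_norm ?subr_le0// opprB lerBlDr -lerBlDl.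
  by apply: le_trans F2; rewrite mulrBl mul1r.
have aF1 : a * F ((1 - ep) * t) <= a * ((1 + dl) * F t) by rewrite ler_wpM2l.
have aF2 : a * F ((1 + ep) * t) <= a * F t by rewrite ler_wpM2l.
have totalF : (k * dl + a * (1 + dl) + 2 * dl) * F t <= (c * B + e) * F t.
  by rewrite ler_pM2r.
have dF : 0 <= dl * F t by rewrite mulr_ge0// ltW.
have adF : 0 <= a * (dl * F t) by rewrite mulr_ge0.
move: (F ((1 - ep) * t)) (F ((1 + ep) * t)) S1 S2 KF1 KF2 aF1 aF2 => x y S1 S2 KF1 KF2 aF1 aF2.
clear F1 F2 F1' F2' a_le Bk0; clearbody f jt.
by apply/andP; split; lra.
Unshelve. all: by end_near. Qed.

Lemma within_le B B' : B <= B' -> within B -> within B'.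
Proof.
move=> BB'; apply: filterS => t h i; apply: le_trans (h i) _.
by rewrite ler_pM2r.
Qed.

Lemma now_lim_asymptotics (e : R) : 0 < e -> within e.
Proof.
move=> e0; have [mX _ _ _] := chain.
have [C0 C00 C0P] := now_abs_perpetuity_bound.
have B0 : 0 < C0 + k by rewrite ltr_wpDr.
(* Crude start: the tail is at most C0 F and |K| F is at most k F. *)
have w0 : within (C0 + k).
  apply: nearW => t i; rewrite mulrDl; apply: le_trans (ler_normB _ _) _.
  apply: lerD; last by rewrite normrM (ger0_norm (F_ge0 t)) ler_pM2r ?K_le.
  rewrite ger0_norm ?now_ge0//; apply: (@le_trans _ _ (now i (tail (@abs_lim R D) t))).
    apply: le_cP => //.
    - apply: measurable_onset; first exact: measurable_history mX mQM 0.
      exact: measurable_tail (@measurable_perpetuity_lim R D).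
    - apply: measurable_onset; first exact: measurable_history mX mQM 0.
      exact: measurable_tail (@measurable_abs_lim R D).
    - by move=> w /= h; apply: lt_le_trans h (lee_abs _).
  by apply: now_abs_lim_le => // N; exact: C0P.
(* The contraction with e = (1 - c) B / 2 sends B to r B, and r < 1. *)
pose r := (1 + c) / 2.
have [c0 c1] := (c_ge0, c_lt1).
have r0 : 0 < r by rewrite /r; lra.
have r1 : r < 1 by rewrite /r; lra.
have rc : r = c + (1 - c) / 2 by rewrite /r; lra.
have c2 : 0 < (1 - c) / 2 by lra.
have iter n : within (r ^+ n * (C0 + k)).
  elim: n => [|n IH]; first by rewrite expr0 mul1r.
  have rn : 0 < r ^+ n * (C0 + k) by rewrite mulr_gt0// exprn_gt0.
  apply: within_le (within_contraction (ltW rn) (mulr_gt0 c2 rn) IH).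
  by rewrite -mulrDl -rc mulrA -exprS.
have [n rn] := expr_unbounded r^-1 ((C0 + k) / e) ltac:(by rewrite invf_gt1).
apply: within_le (iter n).
move: rn; rewrite exprVn ler_pdivrMr// => rn.
by rewrite mulrC -ler_pdivlMr ?exprn_gt0// mulrC.
Qed.

(** If K_i were negative, a probability within |K_i| F(t) / 2 of K_i F(t) would be negative. *)
Lemma K_ge0 i : 0 <= K i.
Proof.
rewrite leNgt; apply/negP => K0; have e0 : 0 < - K i / 2 by rewrite divr_gt0// oppr_gt0.
near (@pinfty_nbhs R) => t.
have : forall i', `|now i' (limit_tail t) - K i' * F t| <= - K i / 2 * F t.
  by near: t; exact: now_lim_asymptotics.
move=> /(_ i); rewrite ler_norml => /andP[_ h].
have h1 := now_ge0 P X Q M i (limit_tail t).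
have h2 : K i * F t < 0 by rewrite nmulr_rlt0.
have h3 : - K i / 2 * F t = - (K i * F t) / 2 by ring.
by move: h; rewrite h3; lra.
Unshelve. all: by end_near. Qed.

End Asymptotics.

(** * Irreducibility of the reversed chain *)

Section Irreducibility.
Context d (T : measurableType d) (R : realType) (P : probability T R) (D : countType).
Variable X : int -> T -> D.
Hypothesis chain : stationary_irreducible_markov_chain P X.

Let mX : markov_events_measurable X. Proof. by case: chain. Qed.

Lemma Pr_two_states_shift (l k m : int) i j :
  Pr P ([set w | X (k + m) w = i] `&` [set w | X (l + m) w = j]) =
  Pr P ([set w | X k w = i] `&` [set w | X l w = j]).
Proof.
have [_ stat _ _] := chain; have := stat m [:: (k, i); (l, j)].
by rewrite /= !cyl_cons cyl_nil !setIT.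
Qed.

(** A path of the chain from j to i, read backwards, is a path of H from i to j. The induction on
    its length peels off a value of X_{-1} of positive joint probability. *)
Lemma reversed_closed_full (Z : D -> Prop) :
  (forall i l, Z i -> 0 < Hrev P X i l -> Z l) ->
  forall i, Z i -> forall j, Z j.
Proof.
move=> Zcl i Zi j.
have claim n : forall i, Z i ->
    0 < Pr P ([set w | X (- n%:Z) w = j] `&` [set w | X 0 w = i]) -> Z j.
  elim: n => [|n IH] {Zi}i Zi.
    rewrite oppr0 => h; have [<-//|ji] := eqVneq i j.
    suff e : [set w | X 0 w = j] `&` [set w | X 0 w = i] = set0.
      by rewrite e Pr_set0 ltxx in h.
    by apply/seteqP; split => // w [/= -> ji']; rewrite ji' eqxx in ji.
  set S := _ `&` _ => S0.
  have mS : measurable S by exact: measurableI.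
  have [l Sl] : exists l, 0 < Pr P (S `&` [set w | X (-1) w = l]).
    apply: contrapT => /forallNP h; have := Pr_total chain mS.
    rewrite esum1; first by move=> [] S00; rewrite S00 ltxx in S0.
    move=> l _; congr EFin; apply/eqP; rewrite eq_le Pr_ge0 andbT leNgt.
    exact/negP/h.
  apply: (IH l).
    apply: (Zcl i) => //; rewrite (Hrev_past chain) divr_gt0 ?Pr_state_gt0//.
    apply: lt_le_trans Sl _; apply: le_Pr; [exact: measurableI|exact: measurableI|].
    by move=> w [[_ ?] ?].
  rewrite -(Pr_two_states_shift 0 (- n%:Z) (-1)) add0r.
  rewrite (_ : - n%:Z - 1 = - n.+1%:Z); last by rewrite -addn1 PoszD opprD.
  apply: lt_le_trans Sl _; apply: le_Pr; [exact: measurableI|exact: measurableI|].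
  by move=> w [[? _] ?].
have [_ _ _ irr] := chain; have [n] := irr j i.
rewrite -(Pr_two_states_shift n%:Z 0 (- n%:Z)) add0r subrr; exact: claim.
Qed.

End Irreducibility.

(** * Reduction of the theorem to the abstract asymptotics *)

Lemma fine_m_pos_m_neg d (T : measurableType d) (R : realType) (P : probability T R)
    (D : countType) (M : int -> D -> T -> R) (al : R) (i : D) :
  measurable_fun setT (M 0 i) -> Pr P [set w | 0 < M 0 i w] = 1 ->
  fine (m_pos P M al i + m_neg P M al i)%E = moment P (M 0 i) al.
Proof.
move=> mM P1; have m0 := measurable_above mM 0.
have posE : m_pos P M al i = (\int[P]_(w in [set w | (0 < M 0 i w)%R]) (M 0 i w `^ al)%:E)%E.
  rewrite /m_pos [RHS]integral_mkcond; apply: eq_integral => w _; rewrite /patch.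
  have [M0|M0] := ltP 0 (M 0 i w); first by rewrite mem_set//= mulr1 gtr0_norm.
  by rewrite memNset/= ?mulr0//; apply/negP; rewrite -leNgt.
have mN : measurable [set w | M 0 i w < 0].
  by rewrite -[X in measurable X]setTI; apply: measurable_fun_ltr.
have PN : P [set w | M 0 i w < 0] = 0%E.
  have mC : measurable (~` [set w | 0 < M 0 i w]) by exact: measurableC.
  have PC : P (~` [set w | 0 < M 0 i w]) = 0%E.
    by rewrite probability_setC// PrE// P1 subee.
  apply: (subset_measure0 mN mC _ PC).
  by move=> w /= h; apply/negP; rewrite -leNgt ltW.
have negE : m_neg P M al i = 0%E.
  rewrite /m_neg.
  rewrite (_ : integral _ _ _ =
      (\int[P]_(w in [set w | (M 0 i w < 0)%R]) (`|M 0 i w| `^ al)%:E)%E).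
    apply: null_set_integral => //; apply/measurable_EFinP.
    apply: measurable_funS (_ : measurable_fun setT _) => //.
    by apply: (measurableT_comp (measurable_powR al)); exact: measurableT_comp.
  rewrite [RHS]integral_mkcond; apply: eq_integral => w _; rewrite /patch.
  have [h|h] := ltP (M 0 i w) 0; first by rewrite mem_set//= mulr1.
  by rewrite memNset/= ?mulr0//; apply/negP; rewrite -leNgt.
by rewrite posE negE adde0.
Qed.

Unset Implicit Arguments. Set Strict Implicit. Set Printing Implicit Defensive.

Theorem theorem1 (R : realType) (d : measure_display) (T : measurableType d)
  (P : probability T R) (D : countType)
  (X : int -> T -> D) (Q M : int -> D -> T -> R)
  (alpha : R) (L : R -> R) (q1 qm1 : D -> R) (K : D -> R) :
  (* setting *)
  stationary_irreducible_markov_chain P X ->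
  pairs_measurable Q M ->
  pairs_independent_of_chain P X Q M ->
  pairs_identically_distributed P Q M ->
  (* Assumption (A) *)
  0 < alpha ->
  (* (A1) *)
  slowly_varying L ->
  (forall i, 0 <= q1 i) -> (forall i, 0 <= qm1 i) ->
  (forall e : R, 0 < e -> exists t0 : R, forall t : R, t0 < t -> forall i : D,
      `| Pr P [set w | t < Q 0 i w] / (t `^ (- alpha) * L t) - q1 i | < e /\
      `| Pr P [set w | t < - Q 0 i w] / (t `^ (- alpha) * L t) - qm1 i | < e) ->
  (0 < \esum_(j in [set: D]) (q1 j)%:E)%E ->
  (exists C : R, forall j, q1 j <= C /\ qm1 j <= C) ->
  (* (A2) *)
  (exists beta : R, alpha < beta /\ exists C : R, forall i : D,
      (\int[P]_w (`|M 0 i w| `^ beta)%:E <= C%:E)%E) ->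
  (* (A3) *)
  (exists c : R, c < 1 /\ forall i : D, (m_pos P M alpha i + m_neg P M alpha i <= c%:E)%E) ->
  (* (A4) *)
  (forall delta : R, 0 < delta -> exists eps0 : R, 0 < eps0 /\
     forall eps : R, 0 < eps -> eps < eps0 -> forall i : D,
       `| Pr P [set w | M 1 i w <= eps] - Pr P [set w | M 1 i w <= 0] | < delta) ->
  (* additional hypothesis: P(M_{0,i} > 0) = 1 *)
  (forall i : D, Pr P [set w | 0 < M 0 i w] = 1) ->
  (* K = (I - G)^{-1} q^{(1)} in B_b: the bounded solution of (I - G) K = q^{(1)} *)
  (exists C : R, forall i, `| K i | <= C) ->
  (forall i : D, K i - csum (fun j => Gmat P X M alpha i j * K j) = q1 i) ->
  forall i : D,
    asymp_equiv
      (fun t => cprob P [set w | (t%:E < R_sol X Q M w)%E] [set w | X 0 w = i])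
      (fun t => K i * (t `^ (- alpha) * L t)).

Proof.
move=> chain mQM indep ident al0 Lsv q0 qm0 A1 qsum [qC qCP] [be [al_be [C CP]]] [c [c1 cP]] _.
move=> M0 [k kP] Keq i.
have mQ j : measurable_fun setT (Q 0 j) by case: (mQM 0 j).
have mM j : measurable_fun setT (M 0 j) by case: (mQM 0 j).
have mX : markov_events_measurable X by case: chain.
have [j0 qj0] : exists j0, 0 < q1 j0.
  apply: contrapT => /forallNP h; move: qsum; rewrite esum1 ?ltxx// => j _.
  by congr EFin; apply/eqP; rewrite eq_le q0 andbT leNgt; exact/negP/h.
pose ell (t : R) := t `^ (- alpha) * L t.
(* Being a tail, this stand-in for [ell] is nonincreasing and bounded, which [ell] need not be; the
   division by q_{j0} makes the two equivalent. *)
pose F t := Pr P [set w | t < Q 0 j0 w] / q1 j0.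
have mQgt j t : measurable [set w | t < Q 0 j w].
  by rewrite -[X in measurable X]setTI; apply: measurable_fun_ltr.
have mQlt j t : measurable [set w | t < - Q 0 j w].
  rewrite -[X in measurable X]setTI; apply: measurable_fun_ltr => //.
  exact: measurable_funN.
have F_ge0 t : 0 <= F t by rewrite divr_ge0 ?Pr_ge0// ltW.
have F_noninc s t : s <= t -> F t <= F s.
  move=> st; rewrite ler_pM2r ?invr_gt0//; apply: le_Pr => // w /=.
  exact: le_lt_trans.
have F_le t : F t <= 1 / q1 j0.
  rewrite ler_pM2r ?invr_gt0// -(@Pr_setT _ _ _ P); exact: le_Pr.
have A1near e : 0 < e -> \forall t \near +oo, forall j,
    `| Pr P [set w | t < Q 0 j w] / ell t - q1 j | < e /\
    `| Pr P [set w | t < - Q 0 j w] / ell t - qm1 j | < e.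
  by move=> /A1[t0 t0P]; exists t0; split; [exact: num_real|exact: t0P].
have F_ell : F t / ell t @[t --> +oo] --> (1 : R).
  apply/cvgrPdist_le => e e0; have := A1near _ (mulr_gt0 e0 qj0).
  apply: filterS => t /(_ j0)[/ltW h _].
  have -> : 1 - F t / ell t = - (Pr P [set w | t < Q 0 j0 w] / ell t - q1 j0) / q1 j0.
    by rewrite /F; move: (ell t)^-1 => x; field; rewrite gt_eqF.
  by rewrite normrM normrN normfV (gtr0_norm qj0) ler_pdivrMr.
have F_gt0 := equiv_F_gt0 F_ge0 F_noninc F_ell.
have F_rv := equiv_F_rv F_ge0 Lsv F_ell.
have qC0 : 0 <= qC by apply: le_trans (qCP j0).1.
have F_cvg0 : F t @[t --> +oo] --> (0 : R).
  pose Q0 : {mfun T >-> R} :=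
    HB.pack (Q 0 j0) (isMeasurableFun.Build _ _ _ _ (Q 0 j0) (mQ j0)).
  have cc := cvg_ccdfy0 (P := P) (Q0 : {RV P >-> R}).
  have : Pr P [set w | t < Q 0 j0 w] @[t --> +oo] --> (0 : R).
    have -> : (fun t => Pr P [set w | t < Q 0 j0 w]) = fine \o ccdf (P := P) Q0.
      apply/funext => t; rewrite /ccdf /distribution /pushforward /Pr /=.
      by congr (fine (P _)); apply/seteqP; split => w /=; rewrite in_itv/= andbT.
    by apply: fine_cvg; exact: cc.
  move=> h; have h2 := cvgM h (cvg_cst (q1 j0)^-1).
  by rewrite mul0r in h2; exact: h2.
have Q_tail e : 0 < e -> \forall t \near +oo, forall j,
    `|Pr P [set w | t < Q 0 j w] - q1 j * F t| <= e * F t /\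
    `|Pr P [set w | t < - Q 0 j w] - qm1 j * F t| <= e * F t.
  (* Passing from [ell] to [F] costs e1 (2 + qC): the 2 from ell <= 2 F, and qC from |F - ell| <= e1
     F multiplied by q <= qC. *)
  move=> e0; pose e1 := Num.min 1 (e / (2 + qC)).
  have den : 0 < 2 + qC by rewrite ltr_wpDr.
  have e10 : 0 < e1 by rewrite lt_min ltr01 divr_gt0.
  have e11 : e1 <= 1 by rewrite ge_min lexx.
  have e1e : e1 * (2 + qC) <= e by rewrite -ler_pdivlMr// ge_min lexx orbT.
  have n1 := A1near _ e10; have n2 := F_ell_near F_ge0 F_ell e10 e11.
  apply: filterS2 n1 n2 => t n1 [Ft lt Fl] j.
  have key p qq : 0 <= qq -> qq <= qC -> `|p / ell t - qq| < e1 ->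
      `|p - qq * F t| <= e * F t.
    move=> qq0 qqC h.
    have h1 : `|p - qq * ell t| <= e1 * ell t.
      have -> : p - qq * ell t = (p / ell t - qq) * ell t by field; rewrite gt_eqF.
      by rewrite normrM (gtr0_norm lt) ler_pM2r// ltW.
    have h2 : ell t <= 2 * F t.
      have : e1 * F t <= F t by rewrite ler_piMl// ltW.
      by move: Fl; rewrite ler_norml -/(ell t) => /andP[? ?]; lra.
    have -> : p - qq * F t = (p - qq * ell t) - qq * (F t - ell t) by ring.
    apply: le_trans (ler_normB _ _) _; rewrite normrM (ger0_norm qq0).
    apply: (@le_trans _ _ (e1 * (2 * F t) + qC * (e1 * F t))).
      apply: lerD; first by apply: le_trans h1 _; rewrite ler_pM2l.
      by apply: ler_pM.
    have -> : e1 * (2 * F t) + qC * (e1 * F t) = e1 * (2 + qC) * F t by ring.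
    by rewrite ler_pM2r.
  have [h1 h2] := n1 j; have [q1C qm1C] := qCP j.
  by split; apply: key.
have Q_pos e : 0 < e -> \forall t \near +oo, forall j,
    `|Pr P [set w | t < Q 0 j w] - q1 j * F t| <= e * F t.
  by move=> /Q_tail; apply: filterS => t h j; case: (h j).
(* Each of the two tails of Q is eventually at most (qC + 1) F. *)
have Cq0 : 0 <= 2 * (qC + 1) by rewrite mulr_ge0// addr_ge0.
have Q_abs : \forall t \near +oo, forall j,
    Pr P [set w | t < `|Q 0 j w|] <= 2 * (qC + 1) * F t.
  apply: filterS (Q_tail _ ltr01) => t h j; have [h1 h2] := h j.
  have [q1C qm1C] := qCP j.
  have -> : [set w | t < `|Q 0 j w|] = [set w | t < Q 0 j w] `|` [set w | t < - Q 0 j w].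
    by apply/seteqP; split => w /=; rewrite ltr_normr => /orP.
  apply: (@le_trans _ _ (Pr P [set w | t < Q 0 j w] + Pr P [set w | t < - Q 0 j w])).
    rewrite -lee_fin EFinD -!PrE//; last exact: measurableU.
    exact: measureU2.
  have h3 : q1 j * F t <= qC * F t by rewrite ler_pM2r.
  have h4 : qm1 j * F t <= qC * F t by rewrite ler_pM2r.
  move: h1 h2; rewrite !ler_norml => /andP[_ h1] /andP[_ h2]; lra.
have momE j : fine (m_pos P M alpha j + m_neg P M alpha j)%E = moment P (M 0 j) alpha.
  exact: fine_m_pos_m_neg.
have mom0 j : 0 <= moment P (M 0 j) alpha by exact: mom_ge0.
have momc j : moment P (M 0 j) alpha <= c.
  rewrite -momE; have := cP j; have : (0 <= m_pos P M alpha j + m_neg P M alpha j)%E.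
    by rewrite adde_ge0// integral_ge0// => w _; rewrite lee_fin mulr_ge0 ?powR_ge0//; case: ifP.
  by case: (_ + _)%E => [r| |].
have c0 : 0 <= c by apply: le_trans (momc i).
have k0 : 0 <= k by apply: le_trans (kP i).
have H0 := Hrev_ge0 P X; have H1 := esum_Hrev chain mQM indep ident.
have KE j : K j = q1 j + moment P (M 0 j) alpha * average (Hrev P X j) K k.
  rewrite -(Keq j) -(csum_average (H0 j) (H1 j) k0 kP (mom0 j)) -momE.
  by rewrite subrK.
have asym e := now_lim_asymptotics chain mQM indep ident M0 al0 al_be CP c0 c1 momc
  F_gt0 F_noninc F_le F_rv F_cvg0 Q_pos Cq0 Q_abs k0 kP KE (e := e).
have Kge0 := K_ge0 chain mQM indep ident M0 al0 al_be CP c0 c1 momc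
  F_gt0 F_noninc F_le F_rv F_cvg0 Q_pos Cq0 Q_abs k0 kP KE.
(* At a zero of K the equation and K >= 0 force the H-average of K to vanish, because the moment of
   M is positive; so K vanishes at all H-successors, and finally at j0, where K is at least q_{j0} >
   0. *)
have Kgt0 : 0 < K i.
  rewrite lt_neqAle Kge0 andbT eq_sym; apply/eqP => Ki.
  have Zcl j l : K j = 0 -> 0 < Hrev P X j l -> K l = 0.
    move=> Kj Hjl; have mp : 0 < moment P (M 0 j) alpha.
      exact: (moment_gt0 (mM j) al0 al_be (CP j) (M0 j)).
    have av := average_ge (H0 j) (H1 j) k0 kP l Kge0.
    have av0 : 0 <= average (Hrev P X j) K k by apply: le_trans av; rewrite mulr_ge0.
    have : moment P (M 0 j) alpha * average (Hrev P X j) K k <= 0.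
      by rewrite -Kj KE lerDr.
    rewrite pmulr_rle0// => av1; have := le_trans av av1; rewrite pmulr_rle0// => Kl.
    by apply/eqP; rewrite eq_le Kl Kge0.
  have Kj0 := reversed_closed_full chain Zcl Ki j0.
  have av := average_ge (H0 j0) (H1 j0) k0 kP j0 Kge0.
  rewrite Kj0 mulr0 in av.
  have := KE j0; rewrite Kj0 => /eqP; rewrite eq_sym gt_eqF//.
  by rewrite ltr_pwDl// mulr_ge0.
pose f t := now P X Q M i (tail (@perpetuity_lim R D) t).
have -> : (fun t => cprob P [set w | (t%:E < R_sol X Q M w)%E] [set w | X 0 w = i]) = f.
  apply/funext => t; rewrite /f /now /cP; congr (cprob P _ _).
  by apply/seteqP; split => w; rewrite /= /tail/= R_sol_history.
rewrite /asymp_equiv.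
have fF : f t / F t @[t --> +oo] --> K i.
  apply/cvgrPdist_le => e e0; apply: filterS (asym e e0) => t /(_ i) h.
  have -> : K i - f t / F t = - (f t - K i * F t) / F t by field; rewrite gt_eqF.
  by rewrite normrM normrN normfV (gtr0_norm (F_gt0 t)) ler_pdivrMr.
(* The inverse of [ell] is treated as an opaque factor, so the identity holds also where [ell]
   vanishes. *)
have -> : (fun t => f t / (K i * (t `^ (- alpha) * L t))) =
    (fun t => f t / F t * (F t / ell t) * (K i)^-1).
  apply/funext => t; rewrite -/(ell t) invfM; move: (ell t)^-1 => x; field.
  by rewrite !gt_eqF.
have lim1 := cvgM (cvgM fF F_ell) (cvg_cst (K i)^-1).
by rewrite mulr1 divff ?gt_eqF// in lim1; exact: lim1.
Qed.
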